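(* Let $D\subset\mathbb{R}^n$ be a bounded domain with $0\in D$ and $m(\partial D)=0$, where $m$ is Lebesgue measure. For $k\ge1$ let $X^k$ be the continuous-time simple random walk on $D_k$ with mean holding time $2^{-2k}$, and let $\mathbf{P}^k_{m_k}$ be its law with initial distribution $m_k$. Then for every $T>0$, the laws of the stationary random walks $\{X^k,\mathbf{P}^k_{m_k},k\ge1\}$ are tight in the space $\mathbf{D}([0,T],\overline D)$ equipped with the Skorokhod topology.
   Context: A domain is a connected open set. Initial distributions are finite measures, not necessarily of total mass 1. $\mathbf{D}([0,T],\mathcal{S})$ is the space of right continuous functions $[0,T]\to\mathcal{S}$ with left limits. Lattice: let $\overline{2^{-k}\mathbb{Z}^n}$ be the union of all closed line segments joining nearest neighbors in $2^{-k}\mathbb{Z}^n$, $D_k^*$ the connected component of $\overline{2^{-k}\mathbb{Z}^n}\cap D$ containing $0$, and $D_k=D_k^*\cap 2^{-k}\mathbb{Z}^n$. For $x,y\in D_k$ write $x\leftrightarrow y$ if $|x-y|=2^{-k}$; $v_k(x)$ is the degree of $x$, i.e. the number of $y\in D_k$ with $y\leftrightarrow x$. The measure $m_k$ on $D_k$ is $m_k(\{x\})=\frac{v_k(x)}{2n}2^{-kn}$. (If $D_k=\{0\}$, which can happen only for finitely many $k$, then $m_k=0$ and the walk is taken to stay at $0$.) Random walk: $X^k$ is the continuous-time Markov chain on $D_k$ which waits at each vertex an exponential time with mean $2^{-2k}$ and then jumps to one of its nearest neighbors in $D_k$ with equal probabilities (jump rate from $x$ to $y\leftrightarrow x$ is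 $2^{2k}/v_k(x)$). It is symmetric with respect to $m_k$, with Dirichlet form $\mathcal{E}^k(f,f)=\frac1{4n}\sum_{x,y\in D_k:\,x\leftrightarrow y}2^{-(n-2)k}(f(x)-f(y))^2$. *)

(* Defs.v *)
From HB Require Import structures.
From mathcomp Require Import all_boot all_order all_algebra finmap.
From mathcomp Require Import all_classical all_reals all_analysis.

Set Implicit Arguments.
Unset Strict Implicit.
Unset Printing Implicit Defensive.

Import Order.TTheory GRing.Theory Num.Theory.
Import numFieldNormedType.Exports.

Local Open Scope classical_set_scope.
Local Open Scope ring_scope.

Notation time T := (set_type `[0, T]%classic).

(* At [t = 0] the filter of left neighbourhoods is improper, so that the
   existence of a left limit is no constraint there; likewise for right
   continuity at [t = T]. *)
Definition is_cadlag (R : realType) (T : R) (S : topologicalType)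
    (f : time T -> S) : Prop :=
  forall t : time T,
    f s @[s --> within [set s : time T | \val t < \val s] (nbhs t)] --> f t /\
    exists l : S,
      f s @[s --> within [set s : time T | \val s < \val t] (nbhs t)] --> l.

Record cadlag (R : realType) (T : R) (S : topologicalType) := Cadlag {
  cadlag_fun :> time T -> S;
  cadlagP : is_cadlag cadlag_fun }.

HB.instance Definition _ (R : realType) (T : R) (S : topologicalType) :=
  gen_eqMixin (cadlag T S).
HB.instance Definition _ (R : realType) (T : R) (S : topologicalType) :=
  gen_choiceMixin (cadlag T S).

Lemma is_cadlag_cst (R : realType) (T : R) (S : topologicalType) (x : S) :
  is_cadlag (fun _ : time T => x).
Proof.
by move=> t; split; [exact: cvg_cst|exists x; exact: cvg_cst].
Qed.

HB.instance Definition _ (R : realType) (T : R) (S : ptopologicalType) :=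
  isPointed.Build (cadlag T S) (Cadlag (is_cadlag_cst (point : S))).

(* The time changes: increasing homeomorphisms [l] of [0,T], given together
   with their inverse [m]. *)
Definition time_change (R : realType) (T : R) (l m : time T -> time T) : Prop :=
  [/\ cancel l m, cancel m l, continuous l, continuous m &
      forall s t : time T, \val s < \val t -> \val (l s) < \val (l t)].

(* The balls of the Skorokhod metric
   d(x,y) = inf_l max(sup_t |l t - t|, sup_t d(x t, y (l t))), up to replacing
   [d(x,y) < e] by [d(x,y) <= e] for some pairs, which does not affect the
   topology. *)
Definition skorokhod_ball (R : realType) (T : R) (S : pseudoMetricType R)
    (x : cadlag T S) (e : R) (y : cadlag T S) : Prop :=
  exists l m : time T -> time T, time_change l m /\
    forall t, `|\val (l t) - \val t| < e /\ ball (x t) e (y (l t)).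

Section skorokhod.
Context (R : realType) (T : R) (S : pseudoMetricType R).
Implicit Types x y z : cadlag T S.

Let sball_center x (e : R) : 0 < e -> skorokhod_ball x e x.
Proof.
move=> e0; exists id, id; split; first by split => // ?; exact: cvg_id.
by move=> t; rewrite subrr normr0; split => //; exact: ballxx.
Qed.

Let sball_sym x y (e : R) : skorokhod_ball x e y -> skorokhod_ball y e x.
Proof.
move=> [l [m [[lm ml cl cm il] xy]]]; exists m, l; split.
  split=> // s t st; rewrite ltNge; apply/negP; rewrite le_eqVlt => /orP[|].
    by move=> /eqP/val_inj/(can_inj ml) ts; rewrite ts ltxx in st.
  by move=> /il; rewrite !ml => /(lt_trans st); rewrite ltxx.
move=> t; have [h1 h2] := xy (m t); rewrite ml in h1 h2.
by split; [rewrite distrC|exact: ball_sym].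
Qed.

Let sball_triangle x y z (e1 e2 : R) :
  skorokhod_ball x e1 y -> skorokhod_ball y e2 z -> skorokhod_ball x (e1 + e2) z.
Proof.
move=> [l [m [[lm ml cl cm il] xy]]] [l' [m' [[lm' ml' cl' cm' il'] yz]]].
exists (l' \o l), (m \o m'); split.
  split.
  - exact: can_comp.
  - exact: can_comp.
  - by move=> t; apply: continuous_comp; [exact: cl|exact: cl'].
  - by move=> t; apply: continuous_comp; [exact: cm'|exact: cm].
  - by move=> s t st; apply/il'/il.
move=> t; have [h1 h2] := xy t; have [h3 h4] := yz (l t); split.
  rewrite (addrC e1); apply: le_lt_trans (ltrD h3 h1).
  exact: (ler_distD (\val (l t))).
exact: ball_triangle h2 h4.
Qed.

HB.instance Definition _ := hasNbhs.Build (cadlag T S)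
  (nbhs_ (entourage_ (@skorokhod_ball R T S))).
HB.instance Definition _ := Nbhs_isPseudoMetric.Build R (cadlag T S)
  erefl sball_center sball_sym sball_triangle erefl.

End skorokhod.

HB.instance Definition _ (R : realType) (T : R) (S : pseudoPMetricType R) :=
  Pointed.on (cadlag T S).

Definition borel (X : ptopologicalType) : Type :=
  g_sigma_algebraType (@open X).
HB.instance Definition _ (X : ptopologicalType) :=
  Measurable.copy (borel X) (g_sigma_algebraType (@open X)).

Definition tight (R : realType) (X : ptopologicalType) (I : Type) (J : set I)
    (mu : I -> {measure set (borel X) -> \bar R}) : Prop :=
  forall e : R, 0 < e -> exists2 K : set X, compact K &
    forall i, J i -> (mu i (~` K) <= e%:E)%E.

(* The sup norm of ['rV[R]_n] only provides the topology; distances between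
   lattice points are Euclidean. *)
Definition edist (R : realType) (n : nat) (x y : 'rV[R]_n) : R :=
  Num.sqrt (\sum_(i < n) (x ord0 i - y ord0 i) ^+ 2).

Definition box (R : realType) (n : nat) (a b : 'rV[R]_n) : set 'rV[R]_n :=
  [set x | forall i, a ord0 i <= x ord0 i <= b ord0 i].

Definition box_vol (R : realType) (n : nat) (a b : 'rV[R]_n) : R :=
  \prod_(i < n) Num.max 0 (b ord0 i - a ord0 i).

(* Lebesgue outer measure on R^n, n > 0; Lebesgue measure is its restriction to
   the Lebesgue measurable sets, which include the closed and the open sets. *)
Definition lebesgue_rV (R : realType) (n : nat) (A : set 'rV[R]_n) : \bar R :=
  ereal_inf [set (\sum_(0 <= j <oo) (box_vol (ab j).1 (ab j).2)%:E)%E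
            | ab in [set ab : nat -> 'rV[R]_n * 'rV[R]_n |
                     A `<=` \bigcup_j box (ab j).1 (ab j).2]].

Definition boundary (X : topologicalType) (A : set X) : set X :=
  closure A `\` A°.

(* The closure of a set containing the origin, with the origin as its point. *)
Definition closure_type (R : realType) (n : nat) (D : set 'rV[R]_n)
  (D0 : D 0) : Type := set_type (closure D).

Section closure_type.
Context (R : realType) (n : nat) (D : set 'rV[R]_n) (D0 : D 0).

HB.instance Definition _ :=
  PseudoMetric.copy (closure_type D0) (set_type (closure D)).
HB.instance Definition _ := isPointed.Build (closure_type D0)
  (exist _ (0 : 'rV[R]_n) (mem_set (subset_closure D0))).

End closure_type.

Section lattice.
Context (R : realType) (n : nat).
Implicit Types (D : set 'rV[R]_n) (k : nat) (x y : 'rV[R]_n).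

Definition lattice k : set 'rV[R]_n :=
  [set x | exists z : 'rV[int]_n, x = 2 ^- k *: map_mx intr z].

Definition grid k : set 'rV[R]_n :=
  [set p | exists x y (s : R), [/\ lattice k x, lattice k y,
    edist x y = 2 ^- k, 0 <= s <= 1 & p = (1 - s) *: x + s *: y]].

Definition Dk D k : set 'rV[R]_n :=
  connected_component (grid k `&` D) 0 `&` lattice k.

Definition adj D k x y : Prop := [/\ Dk D k x, Dk D k y & edist x y = 2 ^- k].

Definition deg D k x : nat := #|` fset_set [set y | adj D k x y]|.

(* [m_k({x})]; it vanishes off [D_k]. *)
Definition mk_mass D k x : R := (deg D k x)%:R / (2 * n)%:R * 2 ^- (k * n).

(* One step of the jump chain; the chain stays put at an isolated vertex, which
   is the case [D_k = {0}]. *)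
Definition jump_prob D k x y : R :=
  if deg D k x == 0%N then (x == y)%:R
  else (`[< adj D k x y >])%:R / (deg D k x)%:R.

End lattice.

(* [Y j] is the [j]-th vertex visited and [H j] the holding time there. The last
   condition says that [Y] is the Markov chain with initial distribution [m_k]
   and transition probabilities [jump_prob], and that the [H j] are exponential
   of mean [2^(-2k)], independent of each other and of [Y]. The law [P] has the
   same total mass as [m_k]. *)
Definition jump_hold_chain (R : realType) (n : nat) (D : set 'rV[R]_n) (k : nat)
    (d : measure_display) (Omega : measurableType d)
    (P : {measure set Omega -> \bar R})
    (Y : nat -> Omega -> 'rV[R]_n) (H : nat -> Omega -> R) : Prop :=
  [/\ forall j w, Dk D k (Y j w),
      forall j y, measurable (Y j @^-1` [set y]),
      forall j, measurable_fun [set: Omega] (H j) &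
      forall (N : nat) (y : nat -> 'rV[R]_n) (B : nat -> set R),
        (forall j, measurable (B j)) ->
        P (\bigcap_(j < N.+1) (Y j @^-1` [set y j] `&` H j @^-1` B j)) =
        ((mk_mass D k (y 0%N) * \prod_(j < N) jump_prob D k (y j) (y j.+1))%:E
         * \prod_(j < N.+1) exponential_prob (2 ^+ (2 * k)) (B j))%E].

(* [mu] is the law on D([0,T], closure D) of the walk [X^k] started from [m_k]:
   the path sits at [Y j] during the [j]-th holding time. *)
Definition walk_law (R : realType) (n : nat) (D : set 'rV[R]_n) (D0 : D 0)
    (T : R) (k : nat)
    (mu : {measure set (borel (cadlag T (closure_type D0))) -> \bar R}) : Prop :=
  exists (d : measure_display) (Omega : measurableType d)
    (P : {measure set Omega -> \bar R})
    (Y : nat -> Omega -> 'rV[R]_n) (H : nat -> Omega -> R)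
    (X : Omega -> borel (cadlag T (closure_type D0))),
  [/\ jump_hold_chain D k P Y H,
      measurable_fun [set: Omega] X,
      {ae P, forall w, forall (t : time T) (j : nat),
        \sum_(i < j) H i w <= \val t < \sum_(i < j.+1) H i w ->
        \val ((X w : cadlag T (closure_type D0)) t) = Y j w} &
      forall A, measurable A -> mu A = pushforward P X A].

(* Main.v *)
(* The closed set K is the closure of a union of sets A_k, where A_k consists of
   the step paths with at most N_k jumps, separated from each other and from the
   ends of [0,T] by at least d_k, that moreover obey a fixed modulus of
   continuity at every precision reached by scale k.  An ultrafilter containing
   the union either contains some A_k, and then jump times and values converge, or
   contains all tails, and then it is asymptotically equicontinuous: in both
   cases it converges.
     The modulus of X^k is controlled block by block, a block being 4^(k-q)
   jumps.  Within a block each coordinate of the jump chain is, by the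
   Lyons-Zheng decomposition of a reversible stationary chain, half the
   difference of a forward and a backward martingale up to O(2^-k), and an
   exponential maximal inequality bounds the probability of an oscillation a by
   C exp(- a 2^q), which beats the number O(4^q) of blocks.  By a Chernoff bound
   on the holding times, a block lasts at least 4^-q / 8 with overwhelming
   probability. *)
Require Import Defs.
From mathcomp Require Import all_boot all_order all_algebra finmap.
From mathcomp Require Import all_classical all_reals all_analysis.
From mathcomp Require Import ring lra zify measurable_realfun.

Set Implicit Arguments.
Unset Strict Implicit.
Unset Printing Implicit Defensive.

Import Order.TTheory GRing.Theory Num.Theory.
Import numFieldNormedType.Exports.

Local Open Scope classical_set_scope.
Local Open Scope ring_scope.

(** * Compactness in the Skorokhod space *)

(** The boundary of the domain is arbitrary, and near it the drift of the walk is of the order of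
    the lattice spacing at each jump. Summed over the roughly 4^k jumps up to time T this is not
    under control, so the walk cannot be treated as a perturbed martingale. In the difference of the
    forward and the backward martingale the drifts cancel up to two boundary terms, thanks to
    reversibility and to stationarity under [m_k]; every estimate then carries the total mass of
    [m_k], which is bounded in k. A path of X^k jumps by 2^-k, so its modulus is small only at
    precisions coarser than that; at a fixed k, compactness has to come from finitely many well
    separated jumps. The Skorokhod metric used here is in general not complete, so limits are built
    along ultrafilters rather than through total boundedness. The probabilistic estimates start from
    upper bounds on the probabilities of finite words, summed backwards from the last coordinate;
    this replaces filtrations and conditional expectations. *)

Lemma ultra_fmap (X Y : Type) (f : X -> Y) (F : set_system X) :
  UltraFilter F -> UltraFilter (fmap f F).
Proof.
move=> UF; split; first exact: fmap_proper_filter.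
move=> G PG FG; rewrite eqEsubset; split=> // A GA.
have [//|FA] := in_ultra_setVsetC (f @^-1` A) UF.
have GCA : G (~` A) by apply: FG.
by have [y []] := filter_ex (filterI GA GCA).
Qed.

Lemma ultra_cvg_compact (X : Type) (S : topologicalType) (f : X -> S)
    (F : set_system X) : compact [set: S] -> UltraFilter F ->
  exists l : S, f x @[x --> F] --> l.
Proof.
rewrite compact_ultra => cS UF.
have [|l [_ h]] := cS _ (ultra_fmap f UF); first exact: filterT.
by exists l.
Qed.

Lemma ultra_cvg_itv (R : realType) (X : Type) (f : X -> R) (a b : R)
    (F : set_system X) : UltraFilter F -> (\forall x \near F, a <= f x <= b) ->
  exists2 l : R, a <= l <= b & f x @[x --> F] --> l.
Proof.
move=> UF Fab; have := @segment_compact R a b; rewrite compact_ultra.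
move=> /(_ _ (ultra_fmap f UF))[|l [abl h]].
  by apply: filterS Fab => x /=; rewrite in_itv.
by exists l => //; move: abl; rewrite /= in_itv.
Qed.

Lemma ultra_bigcup (X : Type) (I : eqType) (s : seq I) (A : I -> set X)
    (F : set_system X) : UltraFilter F ->
  F (\bigcup_(i in [set` s]) A i) -> exists2 i, i \in s & F (A i).
Proof.
move=> UF; elim: s => [|i s IH].
  move=> /filter_ex[x [i]] /=; by rewrite in_nil.
move=> FA; have [Fi|Fi] := in_ultra_setVsetC (A i) UF.
  by exists i => //; rewrite mem_head.
have [|j js Fj] := IH; last by exists j => //; rewrite in_cons js orbT.
apply: filterS (filterI FA Fi) => x [[j /= js Aj] nAi].
by exists j => //=; move: js; rewrite in_cons => /orP[/eqP ji|//];
  rewrite ji in Aj.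
Qed.

(* Every filter meeting [closure A] is shadowed by filters on [A] through the
   thickenings of its members. *)
Lemma ultra_compact_closure (R : realType) (X : pseudoMetricType R)
    (A : set X) :
  (forall F : set_system X, UltraFilter F -> F A -> exists x : X, F --> x) ->
  compact (closure A).
Proof.
move=> hA G PG GA.
pose thick (Ue : set X * R) : set X :=
  [set x | exists2 y, Ue.1 y & ball y Ue.2 x] `&` A.
pose D := [set Ue : set X * R | G Ue.1 /\ 0 < Ue.2].
pose F0 := filter_from D thick.
have PF0 : ProperFilter F0.
  apply: filter_from_proper.
    apply: filter_from_filter; first by exists (setT, 1); split => //;
      exact: filterT.
    move=> [U e] [V d] [/= GU e0] [/= GV d0].
    exists (U `&` V, Num.min e d); first by split;
      [exact: filterI|rewrite lt_min e0].
    move=> x [/= [y [Uy Vy] yx] Ax]; split; split=> //; exists y => //=.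
    - by apply: le_ball yx; rewrite ge_min lexx.
    - by apply: le_ball yx; rewrite ge_min lexx orbT.
  move=> [U e] [/= GU e0].
  have [y [Uy cAy]] := filter_ex (filterI GU GA).
  have [x [Ax yx]] := cAy _ (nbhsx_ballx y e e0).
  by exists x; split => //; exists y.
have [F [UF F0F]] := ultraFilterLemma PF0.
have FA : F A.
  by apply: F0F; exists (setT, 1); [split => //; exact: filterT|move=> x []].
have [p Fp] := hA F UF FA; exists p; split.
  move=> B Bp.
  by have [x [Bx Ax]] := filter_ex (filterI (Fp _ Bp) FA); exists x.
move=> U B GU /nbhs_ballP[e /= e0 peB].
have e20 : 0 < e / 2 by rewrite divr_gt0.
have FU : F (thick (U, e / 2)) by apply: F0F; exists (U, e / 2).
have [x [px [[y /= Uy yx] _]]] :=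
  filter_ex (filterI (Fp _ (nbhsx_ballx p _ e20)) FU).
exists y; split=> //; apply: peB; rewrite [e]splitr.
exact: ball_triangle px (ball_sym yx).
Qed.

Section skorokhod_compactness.
Context (R : realType) (T : R) (S : pseudoMetricType R).
Hypothesis compactS : compact [set: S].
Implicit Types (F : set_system (cadlag T S)) (x y : cadlag T S).

Lemma skorokhod_cvg F (y : cadlag T S) : Filter F ->
  (forall e : R, 0 < e -> \forall x \near F, skorokhod_ball y e x) -> F --> y.
Proof. by move=> FF h; apply/cvg_ballP => e e0; exact: h. Qed.

Lemma skorokhod_ball_sup x y (e : R) : 0 < e ->
  (forall t, ball (x t) e (y t)) -> skorokhod_ball x e y.
Proof.
move=> e0 xy; exists id, id; split; first by split => // ?; exact: cvg_id.
by move=> t; rewrite subrr normr0.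
Qed.

Lemma nbhs_time (t : time T) (e : R) : 0 < e ->
  nbhs t [set s : time T | `|\val s - \val t| < e].
Proof.
move=> e0; apply/nbhs_ballP; exists e => // s; rewrite /= distrC; exact.
Qed.

Lemma time_itv (t : time T) : 0 <= \val t <= T.
Proof. by have := set_mem (valP t); rewrite /= in_itv. Qed.

(** Only one pair (d, e) at a time: a path with jumps of size 2^-k can satisfy this for large e
    while failing it for small e. *)
Definition modulus (d e : R) : set (cadlag T S) :=
  [set x | forall s t : time T, `|\val s - \val t| < d -> ball (x s) e (x t)].

Lemma modulus_cadlag (f : time T -> S) :
  (forall e, 0 < e -> exists2 d, 0 < d &
     forall s t : time T, `|\val s - \val t| < d -> ball (f s) e (f t)) ->
  is_cadlag f.
Proof.
move=> hf; have cf (t : time T) : f s @[s --> t] --> f t.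
  move=> U /nbhs_ballP[e /= e0 eU]; have [d d0 h] := hf e e0.
  apply: (@filterS _ _ (nbhs_filter t) _ _ _ (nbhs_time t d0)) => s /= st.
  by apply: eU; apply: h; rewrite distrC.
move=> t; split; last exists (f t); move=> U /cf h;
  by apply: (@filterS _ _ (nbhs_filter t) _ _ _ h) => s + _.
Qed.

Lemma time_net (d : R) : 0 < d -> exists s : seq (time T),
  forall t : time T, exists2 u, u \in s & `|\val t - \val u| < d.
Proof.
move=> d0; have [T0|T0] := leP 0 T; last first.
  exists [::] => t; have /andP[a b] := time_itv t.
  by have := le_lt_trans (le_trans a b) T0; rewrite ltxx.
have mt (r : R) (h : 0 <= r <= T) : r \in `[0,
  T]%classic by rewrite inE/= in_itv.
pose q := Num.truncn (T / d).
have pr (i : nat) : 0 <= Num.min T (i%:R * d) <= T.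
  apply/andP; split; last by rewrite ge_min lexx.
  by rewrite le_min T0 /= mulr_ge0 // ltW.
pose u (i : nat) : time T := exist (fun r => r \in _) _ (mt _ (pr i)).
exists (map u (iota 0 q.+1)) => t; have /andP[t0 tT] := time_itv t.
have td0 : 0 <= \val t / d by rewrite divr_ge0 // ltW.
have /andP[h1 h2] := truncn_itv td0.
exists (u (Num.truncn (\val t / d))).
  apply: map_f; rewrite mem_iota /= add0n ltnS /q.
  by apply: le_truncn; rewrite ler_pM2r ?invr_gt0.
rewrite ler_pdivlMr // in h1; rewrite ltr_pdivrMr // in h2.
rewrite /u /= min_r; last exact: le_trans h1 tT.
by rewrite ger0_norm ?subr_ge0 //; move: h2;
  rewrite -natr1 mulrDl mul1r ltrBlDl.
Qed.

(** Pointwise limits exist by compactness of [S], and the limit inherits the moduli up to a factor 3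
    in e. A finite net of times then turns pointwise into uniform convergence, so the identity
    serves as time change. For each e some member of F must obey the modulus; that member may depend
    on e. *)
Lemma ultra_cvg_modulus F : UltraFilter F ->
  (forall e, 0 < e -> exists2 d, 0 < d & F (modulus d e)) ->
  exists y : cadlag T S, F --> y.
Proof.
move=> UF hF.
have lim t : exists l : S, (x : cadlag T S) t @[x --> F] --> l.
  exact: ultra_cvg_compact compactS UF.
pose f t := projT1 (cid (lim t)).
have fP t : (x : cadlag T S) t @[x --> F] --> f t := projT2 (cid (lim t)).
have mf e : 0 < e -> exists2 d, 0 < d &
    forall s t : time T, `|\val s - \val t| < d -> ball (f s) e (f t).
  move=> e0; have e30 : 0 < e / 3 by rewrite divr_gt0.
  have [d d0 Fd] := hF _ e30; exists d => // s t st.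
  have Fs : F [set x | ball (f s) (e / 3) (x s)].
    exact: fP (nbhsx_ballx _ _ e30).
  have Ft : F [set x | ball (f t) (e / 3) (x t)].
    exact: fP (nbhsx_ballx _ _ e30).
  have [x [[/= xs xt] mx]] := filter_ex (filterI (filterI Fs Ft) Fd).
  have -> : e = e / 3 + e / 3 + e / 3 by field.
  apply: ball_triangle (ball_sym xt); apply: ball_triangle xs _.
  exact: mx.
exists (Cadlag (modulus_cadlag mf)); apply: skorokhod_cvg => e e0.
have e30 : 0 < e / 3 by rewrite divr_gt0.
have [d1 d10 h1] := hF _ e30; have [d2 d20 h2] := mf _ e30.
have d0 : 0 < Num.min d1 d2 by rewrite lt_min d10.
have [net netP] := time_net d0.
have Fnet : F [set x | forall u, u \in net -> ball (f u) (e / 3) (x u)].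
  elim: net {netP} => [|u net IH]; first by apply: nearW => x u; rewrite in_nil.
  have Fu : F [set x | ball (f u) (e / 3)
    (x u)] by exact: fP (nbhsx_ballx _ _ e30).
  apply: filterS (filterI Fu IH).
  move=> x [/= hu hnet] v; rewrite in_cons => /orP[/eqP ->//|]; exact: hnet.
apply: filterS (filterI Fnet h1) => x [hx mx].
apply: skorokhod_ball_sup => //= t; have [u unet tu] := netP t.
move: tu; rewrite lt_min => /andP[tu1 tu2].
have -> : e = e / 3 + e / 3 + e / 3 by field.
apply: ball_triangle; last by apply: mx; rewrite distrC; exact: tu1.
by apply: ball_triangle (hx _ unet); exact: h2.
Qed.

End skorokhod_compactness.

(** * Time changes close to the identity *)

Section time_changes.
Context (R : realType) (T : R).

Lemma lipschitz_time_continuous (l : time T -> time T) (C : R) : 0 < C ->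
  (forall s t, `|\val (l s) - \val (l t)| <= C * `|\val s - \val t|) ->
  continuous l.
Proof.
move=> C0 lC t U /nbhs_ballP[e /= e0 eU].
have eC : 0 < e / C by rewrite divr_gt0.
apply: (@filterS _ _ (nbhs_filter t) _ _ _ (nbhs_time t eC)) => s /= st.
have : `|\val (l s) - \val (l t)| < e.
  by apply: le_lt_trans (lC s t) _; rewrite mulrC -ltr_pdivlMr.
by rewrite distrC => h; apply: eU; exact: h.
Qed.

(** The slopes of t + phi t lie between 1 - c and 1 + c, so the map is strictly increasing and its
    inverse is Lipschitz with constant 1 / (1 - c). It fixes both ends of [0, T], hence is onto by
    the intermediate value theorem. *)
Lemma time_changeD (phi : R -> R) (c : R) : 0 <= T -> 0 <= c < 1 ->
  (forall s t, `|phi s - phi t| <= c * `|s - t|) -> phi 0 = 0 -> phi T = 0 ->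
  exists l m : time T -> time T, time_change l m /\
    forall t, \val (l t) = \val t + phi (\val t).
Proof.
move=> T0 /andP[c0 c1] phiL phi0 phiT; pose g t := t + phi t.
have mt (r : R) (h : 0 <= r <= T) : r \in `[0,
  T]%classic by rewrite inE/= in_itv.
have gL s t : s <= t -> (1 - c) * (t - s) <= g t - g s <= (1 + c) * (t - s).
  move=> st; have := phiL t s.
  rewrite (ger0_norm (_ : 0 <= t - s)) ?subr_ge0 // ler_norml /g.
  by move=> /andP[h1 h2]; apply/andP; split; lra.
have gi s t : s < t -> g s < g t.
  move=> st; have /andP[h _] := gL _ _ (ltW st); rewrite -subr_gt0.
  by apply: lt_le_trans h; rewrite mulr_gt0 // subr_gt0.
have gm s t : s <= t -> g s <= g t.
  by rewrite le_eqVlt => /orP[/eqP ->//|/gi/ltW].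
have g0 : g 0 = 0 by rewrite /g phi0 addr0.
have gT : g T = T by rewrite /g phiT addr0.
have git (t : time T) : 0 <= g (\val t) <= T.
  have /andP[h1 h2] := time_itv t.
  by have := gm _ _ h1; have := gm _ _ h2; rewrite g0 gT => -> ->.
pose l (t : time T) : time T := exist (fun r => r \in _) _ (mt _ (git t)).
have cg : {within `[0, T], continuous g}.
  apply: continuous_subspaceT => t.
  apply/cvgrPdist_lt => e e0; near=> s.
  have st : `|t - s| < e / 2.
    by near: s; apply: cvgr_dist_lt => //; rewrite divr_gt0.
  have cs x y : x <= y -> `|g x - g y| <= 2 * `|x - y|.
    move=> xy; have /andP[h1 h2] := gL _ _ xy.
    rewrite distrC (distrC x) !ger0_norm ?subr_ge0 ?gm //; nra.
  have : `|g t - g s| <= 2 * `|t - s|.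
    by have [/cs//|/ltW/cs] := leP t s; rewrite distrC (distrC s).
  lra.
have gsurj (u : time T) : exists t : time T, g (\val t) = \val u.
  have /andP[u0 uT] := time_itv u.
  have [|x xT xu] := @IVT R g 0 T (\val u) T0 cg.
    by rewrite g0 gT min_l // max_r // u0 uT.
  by rewrite in_itv /= in xT; exists (exist (fun r => r \in _) x (mt _ xT)).
have [m mP] := choice gsurj.
have lm : cancel m l by move=> u; apply: val_inj; rewrite /= mP.
have linj : injective l.
  move=> s t /(congr1 \val) /= st; apply: val_inj => /=.
  by have [/gi|/gi|//] := ltgtP (sval s) (sval t); rewrite st ltxx.
have ml : cancel l m by move=> t; apply: linj; rewrite lm.
exists l, m; split; last by [].
split => //.
- apply: (@lipschitz_time_continuous _ (1 + c)); first lra.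
  move=> s t /=; wlog st : s t / \val s <= \val t => [hw|].
    by have [/hw//|/ltW/hw] := leP (\val s) (\val t);
      rewrite distrC (distrC (sval t)).
  have /andP[_ h] := gL _ _ st; rewrite distrC (distrC (sval s)).
  by rewrite !ger0_norm ?subr_ge0 ?gm.
- apply: (@lipschitz_time_continuous _ ((1 - c)^-1));
  first by rewrite invr_gt0; lra.
  move=> s t /=; rewrite mulrC ler_pdivlMr; last lra.
  rewrite -(mP s) -(mP t) mulrC.
  move: (m s) (m t) => {}s {}t; wlog st : s t / \val s <= \val t => [hw|].
    by have [/hw//|/ltW/hw] := leP (\val s) (\val t);
      rewrite distrC (distrC (g _)).
  have /andP[h _] := gL _ _ st; rewrite distrC (distrC (g _)).
  by rewrite !ger0_norm ?subr_ge0 ?gm.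
- by move=> s t st /=; exact: gi.
Unshelve. all: end_near. Qed.

(** Bump of height 1 at p, vanishing at distance d: at points that are d apart, sums of tents
    interpolate prescribed values. *)
Definition tent (p d t : R) : R := Num.max 0 (1 - `|t - p| / d).

Lemma tent_lipschitz (p d s t : R) : 0 < d ->
  `|tent p d s - tent p d t| <= `|s - t| / d.
Proof.
move=> d0; have h x y : tent p d x - tent p d y <= `|x - y| / d.
  rewrite lerBlDr /tent ge_max; apply/andP; split.
    by apply: addr_ge0; [rewrite divr_ge0 // ltW|rewrite le_max lexx].
  have hxy : `|y - p| / d <= `|x - y| / d + `|x - p| / d.
    by rewrite -mulrDl ler_pM2r ?invr_gt0 // (distrC x y) ler_distD.
  apply: (@le_trans _ _ (`|x - y| / d + (1 - `|y - p| / d))); first lra.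
  by rewrite lerD2l le_max lexx orbT.
rewrite ler_norml; apply/andP; split; last exact: h.
by rewrite lerNl opprB (distrC s); exact: h.
Qed.

Lemma tent_center (p d : R) : tent p d p = 1.
Proof. by rewrite /tent subrr normr0 mul0r subr0 max_r. Qed.

Lemma tent_far (p d t : R) : 0 < d -> d <= `|t - p| -> tent p d t = 0.
Proof.
move=> d0 h; rewrite /tent max_l // subr_le0.
by rewrite ler_pdivlMr // mul1r.
Qed.

Lemma tent_itv (p d t : R) : 0 < d -> 0 <= tent p d t <= 1.
Proof.
move=> d0; rewrite /tent le_max lexx /= ge_max ler01 /= gerBl.
by rewrite divr_ge0 // ltW.
Qed.

End time_changes.

(** * Paths with finitely many separated jumps *)

Section step_paths.
Context (R : realType) (T : R) (S : pseudoMetricType R).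

(** Counting the jump times already reached gives a meaning to every family [tau], sorted or not, so
    that jump times can pass to the limit one by one. *)
Definition step_fun r (tau : 'I_r -> R) (v : nat -> S) (t : time T) : S :=
  v #|[pred i | tau i <= \val t]|.

Lemma step_fun_cadlag r (tau : 'I_r -> R) (v : nat -> S) :
  is_cadlag (step_fun tau v).
Proof.
move=> t.
have near_time (d : R)
  : 0 < d -> nbhs t [set s : time T | `|\val s - \val t| < d].
  exact: nbhs_time.
split.
  have FF := within_filter [set s : time T | \val t < \val s] (nbhs_filter t).
  move=> U tU; have {}tU := nbhs_singleton tU.
  suff h : (within [set s : time T | \val t < \val s] (nbhs t))
      [set s | forall i, (tau i <= \val s) = (tau i <= \val t)].
    apply: (@filterS _ _ FF _ _ _ h) => s /= hs.
    rewrite [X in U X](_ : _ = step_fun tau v t) // /step_fun.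
    by congr (v _); apply: eq_card => i; rewrite !inE hs.
  apply: (@filter_forall _ _ _ _ FF) => i.
  have [it|ti] := leP (tau i) (\val t).
    apply: (@filterS _ _ (nbhs_filter t) _ _ _ (@filterT _ _ (nbhs_filter t))).
    by move=> s _ /= ts; rewrite (le_trans it) // ltW.
  have d0 : 0 < tau i - \val t by rewrite subr_gt0.
  apply: (@filterS _ _ (nbhs_filter t) _ _ _ (near_time _ d0)) => s /= st _.
  apply/negbTE; rewrite -ltNge; move: (le_lt_trans (ler_norm _) st).
  by rewrite ltrD2r.
exists (v #|[pred i | tau i < \val t]|).
have FF := within_filter [set s : time T | \val s < \val t] (nbhs_filter t).
move=> U tU; have {}tU := nbhs_singleton tU.
suff h : (within [set s : time T | \val s < \val t] (nbhs t))
    [set s | forall i, (tau i <= \val s) = (tau i < \val t)].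
  apply: (@filterS _ _ FF _ _ _ h) => s /= hs.
  rewrite [X in U X](_ : _ = v #|[pred i | tau i < \val t]|) // /step_fun.
  by congr (v _); apply: eq_card => i; rewrite !inE hs.
apply: (@filter_forall _ _ _ _ FF) => i.
have [it|ti] := ltP (tau i) (\val t).
  have d0 : 0 < \val t - tau i by rewrite subr_gt0.
  apply: (@filterS _ _ (nbhs_filter t) _ _ _ (near_time _ d0)) => s /= + _.
  rewrite distrC => st; move: (le_lt_trans (ler_norm _) st).
  by rewrite ltrD2l ltrN2 => /ltW.
apply: (@filterS _ _ (nbhs_filter t) _ _ _ (@filterT _ _ (nbhs_filter t))).
move=> s _ /= st; apply/negbTE; rewrite -ltNge; exact: lt_le_trans ti.
Qed.

(** The displacements tau' i - tau i are interpolated by tents of half-width d. By the separation,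
    each tent vanishes at the other jump times and at 0 and T, and r * eta < d makes the Lipschitz
    constant r * eta / d less than 1. The resulting time change carries tau i to tau' i, so both
    paths have made the same number of jumps at corresponding times. *)
Lemma step_ball r (tau tau' : 'I_r -> R) (v v' : nat -> S) (d eta e : R)
    (x y : cadlag T S) : 0 < d -> 0 <= T -> 0 <= eta ->
  r%:R * eta < d -> r%:R * eta < e ->
  (forall i, d <= tau i <= T - d) ->
  (forall i j, i != j -> d <= `|tau i - tau j|) ->
  (forall i, `|tau' i - tau i| <= eta) ->
  (forall j, (j <= r)%N -> ball (v j) e (v' j)) ->
  (forall t, x t = step_fun tau v t) -> (forall t, y t = step_fun tau' v' t) ->
  skorokhod_ball x e y.
Proof.
move=> d0 T0 eta0 rd re tauT gap tt' vv' xE yE.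
pose phi t := \sum_(i < r) (tau' i - tau i) * tent (tau i) d t.
have sum_eta (F : 'I_r -> R) (b : R) : (forall i, `|F i| <= b) ->
    `|\sum_(i < r) (tau' i - tau i) * F i| <= r%:R * eta * b.
  move=> Fb; apply: le_trans (ler_norm_sum _ _ _) _.
  apply: (@le_trans _ _ (\sum_(i < r) eta * b)).
    by apply: ler_sum => i _; rewrite normrM ler_pM.
  by rewrite sumr_const card_ord -mulrA mulr_natl.
have phiL s t : `|phi s - phi t| <= r%:R * eta / d * `|s - t|.
  rewrite /phi -sumrB; under eq_bigr do rewrite -mulrBr.
  rewrite -mulrA (mulrC d^-1); apply: sum_eta => i; exact: tent_lipschitz.
have tent0 i t : t = 0 \/ t = T -> tent (tau i) d t = 0.
  have /andP[h1 h2] := tauT i => -[->|->]; apply: tent_far => //.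
    by rewrite sub0r normrN (le_trans h1) // ler_norm.
  by apply: le_trans (ler_norm _); lra.
have phi0 : phi 0 = 0 by apply: big1 => i _; rewrite tent0 ?mulr0 //; left.
have phiT : phi T = 0 by apply: big1 => i _; rewrite tent0 ?mulr0 //; right.
have c01 : 0 <= r%:R * eta / d < 1.
  by rewrite divr_ge0 ?mulr_ge0 ?(ltW d0) //= ltr_pdivrMr // mul1r.
have [l [m [lm lE]]] := time_changeD T0 c01 phiL phi0 phiT.
exists l, m; split=> // t; split.
  rewrite lE addrAC subrr add0r.
  apply: le_lt_trans re; rewrite -[leRHS]mulr1; apply: sum_eta => i.
  by have /andP[h1 h2] := tent_itv (tau i) (\val t) d0; rewrite ger0_norm.
have phitau i : phi (tau i) = tau' i - tau i.
  rewrite /phi (bigD1 i) //= tent_center mulr1 big1 ?addr0 // => j ji.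
  by rewrite tent_far ?mulr0 // gap // eq_sym.
(* Monotonicity of t + phi t, read off from the Lipschitz constant of phi, which is less than 1. *)
have tauE i : (tau i <= \val t) = (tau' i <= \val (l t)).
  have -> : tau' i = tau i + phi (tau i) by rewrite phitau addrC subrK.
  rewrite lE; case/andP: c01 => c0 c1.
  have [it|ti] := leP (tau i) (\val t).
    have := phiL (tau i) (\val t).
    rewrite (distrC (tau i)) (ger0_norm (_ : 0 <= \val t - tau i)) ?subr_ge0 //.
    rewrite ler_norml => /andP[_ h]; apply/esym; nra.
  have := phiL (tau i) (\val t).
  rewrite (gtr0_norm (_ : 0 < tau i - \val t)) ?subr_gt0 //.
  rewrite ler_norml => /andP[h _]; apply/esym/negbTE; rewrite -ltNge; nra.
rewrite xE yE /step_fun.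
rewrite (_ : #|_| = #|[pred i | tau' i <= \val (l t)]|).
  by apply: vv'; rewrite (leq_trans (max_card _)) ?card_ord.
by apply: eq_card => i; rewrite !inE tauE.
Qed.

(** The gap d prevents two jumps from merging in the limit, and keeps jumps away from 0 and T, which
    every time change fixes. *)
Definition step_set r (d : R) : set (cadlag T S) :=
  [set x | exists tau : 'I_r -> R, exists v : nat -> S,
    [/\ forall i, d <= tau i <= T - d,
        forall i j, i != j -> d <= `|tau i - tau j| &
        forall t, x t = step_fun tau v t]].

Lemma ultra_cvg_step r (d : R) (F : set_system (cadlag T S)) :
  compact [set: S] -> 0 < d -> 0 <= T -> UltraFilter F -> F (step_set r d) ->
  exists y : cadlag T S, F --> y.
Proof.
move=> cS d0 T0 UF Fstep.
pose P (x : cadlag T S) (p : ('I_r -> R) * (nat -> S)) :=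
  [/\ forall i, d <= p.1 i <= T - d,
        forall i j, i != j -> d <= `|p.1 i - p.1 j| &
        forall t, x t = step_fun p.1 p.2 t].
have [x0 [tau0 [v0 _]]] := filter_ex Fstep.
have [p pP] : {p & forall x, step_set r d x -> P x (p x)}.
  apply: (@choice _ _ (fun x p => step_set r d x -> P x p)) => x.
  have [[tau [v h]]|nx] := pselect (step_set r d x); first by exists (tau, v).
  by exists (tau0, v0).
have FP : F [set x | P x (p x)] by apply: filterS Fstep => x /pP.
have limtau i : exists l : R, (p x).1 i @[x --> F] --> l.
  have [|l _ h] := @ultra_cvg_itv _ _ (fun x => (p x).1 i) d (T - d) F UF.
    by apply: filterS FP => x [].
  by exists l.
have limv j : exists l : S, (p x).2 j @[x --> F] --> l.
  exact: ultra_cvg_compact cS UF.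
have [tau tauP] := choice limtau; have [v vP] := choice limv.
exists (Cadlag (@step_fun_cadlag _ tau v)); apply: skorokhod_cvg => e e0.
pose eta := Num.min (d / 2) (e / 2) / r.+1%:R.
have eta0 : 0 < eta by rewrite divr_gt0 // lt_min !divr_gt0.
have reta : r%:R * eta <= Num.min (d / 2) (e / 2).
  rewrite /eta mulrA ler_pdivrMr // mulrC.
  by rewrite ler_wpM2l ?ler_nat // le_min !divr_ge0 // ltW.
have Ftau : F [set x | forall i, `|(p x).1 i - tau i| <= eta].
  apply: filter_forall => i; have := tauP i => /cvgrPdist_le/(_ _ eta0).
  by apply: filterS => x; rewrite distrC.
have Fv : F [set x | forall j : 'I_r.+1, ball (v j) e ((p x).2 j)].
  by apply: filter_forall => j; exact: vP (nbhsx_ballx _ _ e0).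
apply: filterS (filterI FP (filterI Ftau Fv)) => x [Px [hx hv]].
(* [step_ball] wants the separation of the jump times of its centre, which is known for x; hence the
   ball around x, reversed by symmetry. *)
suff : skorokhod_ball x e (Cadlag (@step_fun_cadlag _ tau v)).
  by move=> h; exact: (@ball_sym _ (cadlag T S) _ _ _ h).
case: Px => h1 h2 h3.
apply: (step_ball d0 T0 (ltW eta0) _ _ h1 h2 _ _ h3) => //.
- by apply: le_lt_trans reta _; rewrite gt_min; apply/orP; left; lra.
- by apply: le_lt_trans reta _; rewrite gt_min; apply/orP; right; lra.
- by move=> i; rewrite distrC.
- move=> j jr; have := hv (Ordinal (jr : (j < r.+1)%N)); exact: ball_sym.
Qed.

End step_paths.

(** * Maximal inequalities for reversible chains *)

Definition upd (V : Type) (y : nat -> V) (l : nat) (z : V) (j : nat) : V :=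
  if j == l then z else y j.

Lemma updE (V : Type) (y : nat -> V) l z : upd y l z l = z.
Proof. by rewrite /upd eqxx. Qed.

Lemma upd_lt (V : Type) (y : nat -> V) l z j : (j < l)%N -> upd y l z j = y j.
Proof. by move=> jl; rewrite /upd ltn_eqF. Qed.

Section ville.
Context (R : realType) d (Omega : measurableType d).
Variable P : {measure set Omega -> \bar R}.

Lemma measure_le_cover (I : eqType) (s : seq I) (A : set Omega)
    (B : I -> set Omega) (b : I -> R) :
  measurable A -> (forall i, measurable (B i)) ->
  (A `<=` \big[setU/set0]_(i <- s) B i) ->
  (forall i, i \in s -> (P (B i) <= (b i)%:E)%E) ->
  (P A <= (\sum_(i <- s) b i)%:E)%E.
Proof.
move=> mA mB AB Bb.
apply: (@le_trans _ _ (P (\big[setU/set0]_(i <- s) B i))).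
  by apply: le_measure; rewrite ?inE //; exact: bigsetU_measurable.
elim: s Bb {AB} => [|i s IH] Bb; first by rewrite !big_nil measure0.
rewrite !big_cons EFinD.
apply: (@le_trans _ _ (P (B i) + P (\big[setU/set0]_(j <- s) B j))%E).
  by apply: measureU2 => //; exact: bigsetU_measurable.
apply: leeD; first by apply: Bb; rewrite mem_head.
by apply: IH => j js; apply: Bb; rewrite in_cons js orbT.
Qed.

Definition cyl (V : Type) (Z : nat -> Omega -> V) (l : nat) (y : nat -> V) :=
  \bigcap_(j < l) (Z j @^-1` [set y j]).

Lemma cyl0 (V : Type) (Z : nat -> Omega -> V) y : cyl Z 0 y = setT.
Proof. by rewrite eqEsubset; split => // w _ j. Qed.

Lemma measurable_cyl (V : Type) (Z : nat -> Omega -> V) l y :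
  (forall j y, (j < l)%N -> measurable (Z j @^-1` [set y])) ->
  measurable (cyl Z l y).
Proof. by move=> mZ; apply: bigcap_measurableType => // j jl; exact: mZ. Qed.

(* Ville's maximal inequality: [G l] is a supermartingale, weighted by the law
   of the first [l] coordinates, until it dominates the event [E]. *)
Lemma ville (V : choiceType) (vs : seq V) (Z : nat -> Omega -> V)
  (E : set Omega)
    (m : nat) (G : nat -> (nat -> V) -> R) (Inv : nat -> (nat -> V) -> Prop)
    (y0 : nat -> V) :
  (forall j w, Z j w \in vs) ->
  (forall j y, measurable (Z j @^-1` [set y])) -> measurable E ->
  Inv 0%N y0 ->
  (forall l y, (l < m)%N -> Inv l y -> (P (cyl Z l y `&` E) <= (G l y)%:E)%E \/
     (forall z, z \in vs -> Inv l.+1 (upd y l z)) /\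
     \sum_(z <- vs) G l.+1 (upd y l z) <= G l y) ->
  (forall y, Inv m y -> (P (cyl Z m y `&` E) <= (G m y)%:E)%E) ->
  (P E <= (G 0 y0)%:E)%E.
Proof.
move=> Zvs mZ mE Inv0 hG Gm.
have mcyl l y : measurable (cyl Z l y `&` E).
  by apply: measurableI => //; exact: measurable_cyl.
(* Backward induction; k counts the coordinates that are still free. *)
have step k y : (k <= m)%N -> Inv (m - k)%N y ->
    (P (cyl Z (m - k) y `&` E) <= (G (m - k)%N y)%:E)%E.
  elim: k y => [|k IH] y km Iy; first by rewrite subn0 in Iy *; exact: Gm.
  have lm : (m - k.+1 < m)%N by rewrite ltn_subrL (leq_trans _ km).
  have [//|[hI hs]] := hG _ y lm Iy.
  have lk : (m - k.+1).+1 = (m - k)%N by rewrite subnSK.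
  rewrite lk in hI hs.
  apply: (@le_trans _ _ (\sum_(z <- vs) G (m - k)%N (upd y (m - k.+1)%N z))%:E);
    last by rewrite lee_fin.
  apply: measure_le_cover; last by move=> z /hI; exact: IH (ltnW km).
  - exact: mcyl.
  - by move=> z; exact: mcyl.
  move=> w [cw Ew]; rewrite -bigcup_seq; exists (Z (m - k.+1)%N w);
    first exact: Zvs.
  split=> // j /=; rewrite -lk ltnS leq_eqVlt => /orP[/eqP ->|jl].
    by rewrite updE.
  by rewrite upd_lt //; exact: cw.
by have := step m y0 (leqnn m); rewrite subnn cyl0 setTI; exact.
Qed.

Lemma measurable_fun_finite_range (V : choiceType) (vs : seq V)
    (Z : Omega -> V) (h : V -> R) :
  (forall w, Z w \in vs) -> (forall y, measurable (Z @^-1` [set y])) ->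
  measurable_fun setT (h \o Z).
Proof.
move=> Zvs mZ _ A mA; rewrite setTI.
rewrite (_ : _ @^-1` A = \big[setU/set0]_(z <- vs | `[< A (h z) >])
  (Z @^-1` [set z])).
  by apply: bigsetU_measurable => z _; exact: mZ.
rewrite -big_filter -bigcup_seq eqEsubset; split=> [w Aw|w [z /= zs zw]].
  exists (Z w) => //=; rewrite mem_filter Zvs andbT; exact/asboolP.
by rewrite zw; move: zs; rewrite mem_filter => /andP[/asboolP].
Qed.

End ville.

(** Since exp (- x) >= 1 - x, it suffices that (1 + x + 2 x^2) (1 - x) = 1 + x^2 (1 - 2 x) is at
    least 1. *)
Lemma expR_le_quadratic (R : realType) (x : R) : x <= 1 / 2 ->
  expR x <= 1 + x + 2 * x ^+ 2.
Proof.
move=> x2; have h := expR_ge1Dx (- x).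
have e0 := expR_gt0 (- x); have e1 : expR x * expR (- x) = 1.
  by rewrite -expRD subrr expR0.
rewrite -(ler_pM2r e0) e1;
  apply: (@le_trans _ _ ((1 + x + 2 * x ^+ 2) * (1 - x))).
  nra.
by apply: ler_wpM2l => //; nra.
Qed.

(** * Exponential inequalities, forward and backward in time *)

Section reversible_chain.
Context (R : realType) (V : choiceType) (vs : seq V).
Variables (p : V -> V -> R) (q : V -> R) (f : V -> R) (c : R).
Hypotheses (p0 : forall x y, 0 <= p x y) (q0 : forall x, 0 <= q x)
  (p1 : forall x, x \in vs -> \sum_(z <- vs) p x z = 1)
  (qp : forall y, \sum_(z <- vs) q z * p z y = q y)
  (pq : forall x y, q x * p x y = q y * p y x)
  (c0 : 0 <= c) (fc : forall x y, p x y != 0 -> `|f x - f y| <= c).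

(** The discrete generator of the chain, applied to f. *)
Definition drift x : R := \sum_(z <- vs) p x z * (f z - f x).

Lemma drift_le x : x \in vs -> `|drift x| <= c.
Proof.
move=> /p1 px; rewrite -[c]mul1r -px mulr_suml.
apply: le_trans (ler_norm_sum _ _ _) _; apply: ler_sum => z _.
rewrite normrM ger0_norm //; have [->|nz] := eqVneq (p x z) 0;
  first by rewrite !mul0r.
by rewrite distrC ler_wpM2l // fc.
Qed.

(** The martingale part of f along the path, in the Doob decomposition. *)
Definition mart (y : nat -> V) (j : nat) : R :=
  f (y j) - f (y 0%N) - \sum_(i < j) drift (y i).

Lemma martS y j :
  mart y j.+1 = mart y j + (f (y j.+1) - f (y j) - drift (y j)).
Proof. by rewrite /mart big_ord_recr /=; ring. Qed.

Lemma mart_eq y y' j : (forall i, (i <= j)%N -> y i = y' i) ->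
  mart y j = mart y' j.
Proof.
move=> yy'; rewrite /mart !yy' //; congr (_ - _); apply: eq_bigr => i _.
by rewrite yy' // ltnW.
Qed.

(** The centred increment is at most 2 c in absolute value, so the exponent is at most 1/2 and the
    quadratic bound applies. The linear term averages to 0, and 2 (2 l c)^2 = 8 l^2 c^2. *)
Lemma exp_step x (l : R) : x \in vs -> `|l| * c <= 1 / 4 ->
  \sum_(z <- vs) p x z * expR (l * (f z - f x - drift x))
    <= expR (8 * l ^+ 2 * c ^+ 2).
Proof.
move=> xvs lc; have gx := drift_le xvs.
have step z : p x z * expR (l * (f z - f x - drift x)) <=
    p x z * (1 + 8 * l ^+ 2 * c ^+ 2) + l * (p x z * (f z - f x - drift x)).
  have [->|nz] := eqVneq (p x z) 0; first by rewrite !mul0r mulr0 addr0.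
  rewrite [X in _ <= _ + X]mulrCA -mulrDr ler_wpM2l //.
  have xi : `|f z - f x - drift x| <= 2 * c.
    apply: le_trans (ler_normB _ _) _; rewrite distrC.
    by have := fc nz; lra.
  set y := f z - f x - drift x in xi *.
  have ly : `|l * y| <= 2 * (`|l| * c).
    by rewrite normrM mulrCA; apply: ler_wpM2l.
  apply: le_trans (expR_le_quadratic _) _.
    by apply: le_trans (ler_norm _) _; apply: le_trans ly _; lra.
  rewrite addrAC lerD2r lerD2l -mulrA -exprMn -(real_normK (num_real (l * y))).
  have -> : 8 * (l * c) ^+ 2 = 2 * (2 * (`|l| * c)) ^+ 2.
    by rewrite !exprMn (real_normK (num_real l)); ring.
  by rewrite ler_pM2l // lerXn2r // ?nnegrE // !mulr_ge0.
apply: le_trans (ler_sum _ (fun z _ => step z)) _.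
rewrite big_split /= -mulr_suml p1 // mul1r -mulr_sumr.
rewrite (_ : \sum_(z <- vs) _ = 0); last first.
  under eq_bigr do rewrite mulrBr.
  by rewrite sumrB -mulr_suml p1 // mul1r subrr.
by rewrite mulr0 addr0 expR_ge1Dx.
Qed.

Context d (Omega : measurableType d) (P : {measure set Omega -> \bar R}).

Definition path_weight l (y : nat -> V) : R :=
  q (y 0%N) * \prod_(j < l) p (y j) (y j.+1).

(** Upper bounds on word probabilities up to a horizon m: in this form the property passes to
    shifted and to time-reversed chains, and a reversed chain has only finitely many steps. *)
Definition chain_le (m : nat) (Z : nat -> Omega -> V) :=
  [/\ forall j w, Z j w \in vs,
      forall j y, measurable (Z j @^-1` [set y]) &
      forall l y, (l <= m)%N -> (P (cyl Z l.+1 y) <= (path_weight l y)%:E)%E].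

Lemma path_weight_ge0 l y : 0 <= path_weight l y.
Proof. by rewrite mulr_ge0 // prodr_ge0. Qed.

Lemma measurable_mart (Z : nat -> Omega -> V) j : (forall j w, Z j w \in vs) ->
  (forall j y, measurable (Z j @^-1` [set y])) ->
  measurable_fun setT (fun w => mart (Z^~ w) j).
Proof.
move=> Zvs mZ; have mh i (h : V -> R) : measurable_fun setT (fun w =>
  h (Z i w)).
  exact: (measurable_fun_finite_range h (Zvs i) (mZ i)).
apply: measurable_funB; first by apply: measurable_funB; exact: mh.
by apply: measurable_sum => i; exact: mh.
Qed.

Lemma mart_max_le (m : nat) (Z : nat -> Omega -> V) (l a : R) :
  chain_le m Z -> 0 <= l -> l * c <= 1 / 4 ->
  let E := [set w | exists2 j, (j <= m)%N & a <= `|mart (Z^~ w) j|] in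
  measurable E /\
  (P E <= ((\sum_(z <- vs) q z) *
    (2 * expR (m%:R * (8 * l ^+ 2 * c ^+ 2) - l * a)))%:E)%E.
Proof.
move=> [Zvs mZ ZW] l0 lc E; set k := 8 * l ^+ 2 * c ^+ 2.
have mE : measurable E.
  rewrite (_ : E = \bigcup_(j in [set j | (j <= m)%N])
      ((fun w => `|mart (Z^~ w) j|) @^-1` `[a, +oo[)); last first.
    rewrite eqEsubset; split=> [w [j jm h]|w [j /= jm h]]; exists j => //=.
      by rewrite in_itv /= h.
    by move: h; rewrite /= in_itv /= andbT.
  apply: bigcup_measurable => j _; rewrite -[_ @^-1` _]setTI.
  apply: measurableT_comp => //; exact: measurable_mart.
(* Exponential supermartingale with j steps left: exp (j k) pays for j future uses of [exp_step],
   and exp (l s) + exp (- l s) treats both signs of the martingale at once. The value is at least 1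
   as soon as |s| >= a. *)
split => //; pose Phi (j : nat) (s : R) :=
  expR (j%:R * k - l * a) * (expR (l * s) + expR (- (l * s))).
have k0 : 0 <= k by rewrite !mulr_ge0 ?sqr_ge0.
have Phi0 j s : 0 <= Phi j s by rewrite mulr_ge0 ?addr_ge0 ?expR_ge0.
have Phi1 j s : a <= `|s| -> 1 <= Phi j s.
  move=> hs; rewrite /Phi mulrDr -!expRD.
  have jk : 0 <= j%:R * k by rewrite mulr_ge0.
  have [s0|s0] := leP 0 s.
    apply: ler_wpDr; first exact: expR_ge0.
    rewrite leNgt expR_lt1 -leNgt.
    rewrite ger0_norm // in hs; rewrite -addrA; apply: addr_ge0 => //;
      rewrite addrC subr_ge0.
    exact: ler_wpM2l.
  apply: ler_wpDl; first exact: expR_ge0.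
  rewrite leNgt expR_lt1 -leNgt.
  rewrite ltr0_norm // in hs; rewrite -addrA; apply: addr_ge0 => //;
    rewrite addrC subr_ge0.
  by rewrite -mulrN; exact: ler_wpM2l.
have PhiS x j s : x \in vs ->
    \sum_(z <- vs) p x z * Phi j (s + (f z - f x - drift x)) <= Phi j.+1 s.
  move=> xvs; set A := expR (j%:R * k - l * a).
  have eqz z : p x z * Phi j (s + (f z - f x - drift x)) =
      A * (expR (l * s) * (p x z * expR (l * (f z - f x - drift x))) +
           expR (- (l * s)) * (p x z * expR (- l * (f z - f x - drift x)))).
    by rewrite /Phi -/A (mulrDr l) opprD !expRD mulNr; ring.
  under eq_bigr do rewrite eqz.
  rewrite -mulr_sumr big_split /= -!mulr_sumr.
  have e1 := @exp_step x l xvs; rewrite ger0_norm // in e1.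
  have e2 := @exp_step x (- l) xvs; rewrite normrN ger0_norm // sqrrN in e2.
  have -> : Phi j.+1 s = A * (expR (l * s) * expR k + expR (- (l * s))
    * expR k).
    rewrite /Phi -natr1 mulrDl mul1r addrAC expRD -/A; ring.
  rewrite ler_pM2l ?expR_gt0 //.
  by apply: lerD; apply: ler_wpM2l; rewrite ?expR_ge0 //; [exact: e1|exact: e2].
pose G (i : nat) (y : nat -> V) : R :=
  if i is i'.+1 then path_weight i' y * Phi (m - i')%N (mart y i')
  else (\sum_(z <- vs) q z) * Phi m 0.
(* The martingale stays below a in absolute value before the last fixed coordinate. At that
   coordinate it may reach a; the first alternative of [ville] then stops the induction. *)
pose Inv (i : nat) (y : nat -> V) :=
  (forall j, (j < i)%N -> y j \in vs) /\
  (forall j, (j.+1 < i)%N -> `|mart y j| < a).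
(* [ville] starts from some sequence of states. If there are no states there are no outcomes either,
   and the event is empty. *)
have [vs0|[v0 _]] : vs = [::] \/ exists v, v \in vs.
- by case: (vs) => [|v s]; [left|right; exists v; rewrite mem_head].
- rewrite (_ : E = set0) ?measure0 ?lee_fin; last first.
    by rewrite -subset0 => w _; have := Zvs 0%N w; rewrite vs0 in_nil.
  by rewrite !mulr_ge0 ?expR_ge0 // sumr_ge0.
suff : (P E <= (G 0%N (fun=> v0))%:E)%E.
  move=> h; apply: le_trans h _; rewrite /G /Phi mulr0 oppr0 expR0 lee_fin.
  by rewrite (mulrC (expR _)).
apply: (@ville _ _ _ _ _ vs Z E m.+1 G Inv) => //.
- move=> [|i] y im [yvs yM].
    right; split.
      by move=> z zvs; split => // -[|j] // _; rewrite updE.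
    rewrite /G /= subn0 mulr_suml; apply: ler_sum => z _.
    by rewrite /path_weight big_ord0 mulr1 /mart big_ord0 !updE !subrr.
  rewrite !ltnS in im.
  have [h|h] := leP a `|mart y i|.
    left; apply: (@le_trans _ _ (P (cyl Z i.+1 y))).
      apply: le_measure; [rewrite inE|rewrite inE|exact: subIsetl].
        by apply: measurableI => //; exact: measurable_cyl.
      exact: measurable_cyl.
    apply: le_trans (ZW _ _ (ltnW im)) _; rewrite lee_fin /G.
    by rewrite ler_peMr ?path_weight_ge0 // Phi1.
  have ui z j : (j <= i)%N -> upd y i.+1 z j = y j by move=> ji; rewrite upd_lt.
  right; split.
    move=> z zvs; split=> j; rewrite ltnS.
      rewrite leq_eqVlt => /orP[/eqP ->|ji]; first by rewrite updE.
      by rewrite upd_lt //; exact: yvs.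
    rewrite ltnS => ji; rewrite (@mart_eq _ y) => [|j' j'j].
      by move: ji; rewrite leq_eqVlt => /orP[/eqP ->//|ji]; exact: yM.
    by rewrite ui // (leq_trans j'j).
  rewrite /G /=.
  have yi := yvs i (ltnSn _).
  apply: (@le_trans _ _ (path_weight i y *
      \sum_(z <- vs) p (y i) z * Phi (m - i.+1)%N
        (mart y i + (f z - f (y i) - drift (y i))))).
    rewrite mulr_sumr; apply: ler_sum => z _.
    have -> : path_weight i.+1 (upd y i.+1 z) = path_weight i y * p (y i) z.
      rewrite /path_weight big_ord_recr /= updE !ui // mulrA.
      by do 2! congr (_ * _); apply: eq_bigr => j _; rewrite !ui // ltnW.
    by rewrite martS updE (@mart_eq _ y) => [|j /ui//]; rewrite ui // -mulrA.
  apply: ler_wpM2l; first exact: path_weight_ge0.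
  have -> : (m - i)%N = (m - i.+1).+1 by rewrite subnSK.
  exact: PhiS.
- move=> y [yvs yM]; rewrite /G subnn.
  have [h|h] := leP a `|mart y m|.
    apply: (@le_trans _ _ (P (cyl Z m.+1 y))).
      apply: le_measure; [rewrite inE|rewrite inE|exact: subIsetl].
        by apply: measurableI => //; exact: measurable_cyl.
      exact: measurable_cyl.
    apply: le_trans (ZW _ _ (leqnn m)) _; rewrite lee_fin.
    by rewrite ler_peMr ?path_weight_ge0 // Phi1.
  rewrite (_ : _ `&` _ = set0) ?measure0 ?lee_fin; last first.
    rewrite -subset0 => w [cw [j jm]].
    rewrite (@mart_eq _ y) => [|i ij]; last by apply: cw => /=;
      rewrite ltnS (leq_trans ij).
    rewrite leNgt; move: jm; rewrite leq_eqVlt => /orP[/eqP ->|jm];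
      first by rewrite h.
    by rewrite yM.
  by rewrite mulr_ge0 ?path_weight_ge0.
Qed.

Section stationary_path.
Variable Y : nat -> Omega -> V.
Hypotheses (Yvs : forall j w, Y j w \in vs)
  (mY : forall j y, measurable (Y j @^-1` [set y]))
  (YW : forall l y, (P (cyl Y l.+1 y) <= (path_weight l y)%:E)%E).

(** Stationarity: sum over the state just before the window and use the invariance [qp], once per
    unit of shift. *)
Lemma chain_shift i m : chain_le m (fun j => Y (i + j)%N).
Proof.
split=> // l y _; elim: i l y => [|i IH] l y; first exact: YW.
pose y' z j := if j is j'.+1 then y j' else z : V.
apply: (@le_trans _ _ (\sum_(z <- vs) path_weight l.+1 (y' z))%:E).
  apply: (@measure_le_cover _ _ _ _ _ vs _
    (fun z => cyl (fun j => Y (i + j)%N) l.+2 (y' z))).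
  - exact: measurable_cyl.
  - by move=> z; exact: measurable_cyl.
  - move=> w cw; rewrite -bigcup_seq; exists (Y i w); first exact: Yvs.
    by move=> [|j] jl /=; rewrite ?addn0 // addnS -addSn; exact: cw.
  - by move=> z _; exact: IH.
rewrite lee_fin /path_weight.
under eq_bigr do rewrite big_ord_recl /= mulrA.
by rewrite -mulr_suml qp.
Qed.

(** Detailed balance moves the weight q along the path, one edge at a time. *)
Lemma path_weight_rev l y :
  path_weight l (fun j => y (l - j)%N) = path_weight l y.
Proof.
rewrite /path_weight subn0.
have -> : \prod_(j < l) p (y (l - j)%N) (y (l - j.+1)%N) =
    \prod_(j < l) p (y j.+1) (y j).
  rewrite (reindex_inj rev_ord_inj) /=; apply: eq_bigr => j _.
  by rewrite !subKn // ?subnSK // subKn // ltnW.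
elim: l => [|l IH]; first by rewrite !big_ord0.
by rewrite !big_ord_recr /= [LHS]mulrCA pq [RHS]mulrA -IH; ring.
Qed.

(** The first l steps of the reversed chain spell, read backwards, a word of the original chain
    starting at time i + (m - l). *)
Lemma chain_reverse i m : chain_le m (fun j => Y (i + (m - j))%N).
Proof.
split=> // l y lm; rewrite -path_weight_rev.
have [_ _ h] := chain_shift (i + (m - l)) l.
apply: le_trans (h l (fun j => y (l - j)%N) (leqnn l)).
apply: le_measure; [rewrite inE|rewrite inE|]; try exact: measurable_cyl.
move=> w cw j /=; rewrite ltnS => jl.
have -> : (i + (m - l) + j = i + (m - (l - j)))%N.
  by rewrite -addnA subnBA // addnBAC // addnC.
by apply: cw; rewrite /= ltnS leq_subr.
Qed.

(* Lyons-Zheng: the increments of [f] are half the difference of a forward and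
   a backward martingale, up to the boundary drift terms. *)
Lemma lyons_zheng (y : nat -> V) m j : (j <= m)%N ->
  2 * (f (y j) - f (y 0%N)) = mart y j
    - (mart (fun i => y (m - i)%N) m - mart (fun i => y (m - i)%N) (m - j)%N)
    + (drift (y 0%N) - drift (y j)).
Proof.
move=> jm; rewrite /mart subnn subKn // subn0.
have -> : \sum_(i < m) drift (y (m - i)%N) =
    \sum_(i < m - j) drift (y (m - i)%N) + \sum_(i < j) drift (y i.+1).
  have h (F : nat -> R) b : \sum_(i < b + j) F i =
      \sum_(i < b) F i + \sum_(i < j) F (b + i)%N by rewrite big_split_ord.
  have := h (fun i => drift (y (m - i)%N)) (m - j)%N; rewrite subnK // => ->.
  congr (_ + _); rewrite (reindex_inj rev_ord_inj) /=; apply: eq_bigr => i _.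
  congr (drift (y _)); have := ltn_ord i; lia.
have : \sum_(i < j) drift (y i.+1) - \sum_(i < j) drift (y i) = drift (y j)
  - drift (y 0%N).
  by rewrite -sumrB -(big_mkord xpredT (fun i => drift (y i.+1) - drift (y i)))
    telescope_sumr.
lra.
Qed.

(** In [lyons_zheng], three martingale values below a and two drifts of at most c give, after
    halving, 3/2 a + c. The factor 4 is 2 for the forward plus 2 for the backward maximal
    inequality. *)
Lemma block_oscillation (i m : nat) (l a : R) : 0 <= l -> l * c <= 1 / 4 ->
  exists N : set Omega, [/\ measurable N,
    (P N <= (\sum_(z <- vs) q z *
      (4 * expR (m%:R * (8 * l ^+ 2 * c ^+ 2) - l * a)))%:E)%E &
    forall w, ~ N w -> forall j, (j <= m)%N ->
      `|f (Y (i + j)%N w) - f (Y i w)| <= 3 / 2 * a + c].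
Proof.
move=> l0 lc.
have [m1 P1] := mart_max_le a (chain_shift i m) l0 lc.
have [m2 P2] := mart_max_le a (chain_reverse i m) l0 lc.
move: m1 P1 m2 P2; set N1 := [set w | _]; set N2 := [set w | _] => m1 P1 m2 P2.
exists (N1 `|` N2); split; first exact: measurableU.
  apply: le_trans (measureU2 _ _ _) _ => //.
  apply: le_trans (leeD P1 P2) _; rewrite -EFinD lee_fin -mulr_suml.
  by rewrite -mulrDr ler_wpM2l ?sumr_ge0 // -mulrDl; lra.
move=> w /not_orP[nN1 nN2] j jm.
have h1 : `|mart (fun j => Y (i + j)%N w) j| < a.
  by rewrite ltNge; apply/negP => h; apply: nN1; exists j.
have h2 j' : (j' <= m)%N -> `|mart (fun j => Y (i + (m - j))%N w) j'| < a.
  by move=> jm'; rewrite ltNge; apply/negP => h; apply: nN2; exists j'.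
have := @lyons_zheng (fun j => Y (i + j)%N w) m j jm; rewrite addn0 => LZ.
have := h2 _ (leqnn m); have := h2 _ (leq_subr j m); move: h1 LZ.
have := drift_le (Yvs i w); have := drift_le (Yvs (i + j) w).
rewrite !ltr_norml !ler_norml =>
  /andP[? ?] /andP[? ?] /andP[? ?] ? /andP[? ?] /andP[? ?].
apply/andP; split; lra.
Qed.

End stationary_path.

End reversible_chain.

Local Notation edist := Defs.edist.

(** * The jump chain on the lattice and its reversible measure *)

Section lattice_walk.
Context (R : realType) (n : nat) (D : set 'rV[R]_n) (B k : nat).
Hypothesis DB : forall x, D x -> forall i, `|x ord0 i| <= B%:R.

Let c : R := 2 ^- k.
Let c0 : 0 < c. Proof. by rewrite invr_gt0 exprn_gt0. Qed.

(** Used with radius B 2^k for [Dk] and with radius 1 for the neighbours of a vertex. *)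
Lemma lattice_box_card (z0 : 'rV[int]_n) (b : nat) (A : set 'rV[R]_n) :
  (forall x, A x -> exists2 z : 'rV[int]_n, x = 2 ^- k *: map_mx intr z &
     forall i, (absz (z ord0 i - z0 ord0 i)%R <= b)%N) ->
  finite_set A /\ (#|` fset_set A| <= (2 * b).+1 ^ n)%N.
Proof.
move=> hA; pose F := {ffun 'I_n -> 'I_(2 * b).+1}.
pose phi (f : F) : 'rV[R]_n :=
  2 ^- k *: map_mx intr (\row_i ((f i)%:Z - b%:Z + z0 ord0 i)).
pose s := [seq phi f | f <- enum F].
have As x : A x -> x \in s.
  move=> /hA[z -> zb]; apply/mapP.
  exists [ffun i => inord (absz (z ord0 i - z0 ord0 i + b%:Z)%R)];
    first by rewrite mem_enum.
  congr (_ *: map_mx _ _); apply/rowP => i; rewrite mxE ffunE.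
  have := zb i; move: (z ord0 i) (z0 ord0 i) => u v huv.
  rewrite inordK; lia.
have fA : finite_set A by apply: sub_finite_set (finite_seq s) => x /As.
split=> //; rewrite (leq_trans (uniq_leq_size (fset_uniq _)
  (_ : {subset _ <= s}))) //.
  by move=> x; rewrite in_fset_set // inE => /As.
by rewrite size_map -cardT card_ffun !card_ord.
Qed.

Lemma Dk_card : finite_set (Dk D k) /\
  (#|` fset_set (Dk D k)| <= (2 * (B * 2 ^ k)).+1 ^ n)%N.
Proof.
apply: (@lattice_box_card 0) => x [xD [z xz]]; exists z => // i;
  rewrite mxE subr0.
have Dx : D x by have /connected_component_sub := xD => -[].
have := DB Dx i; rewrite xz !mxE normrM gtr0_norm // ler_pdivrMl ?exprn_gt0 //.
by rewrite -intr_norm -abszE -pmulrn -natrX -natrM ler_nat mulnC.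
Qed.

Lemma finite_Dk : finite_set (Dk D k). Proof. exact: Dk_card.1. Qed.

Lemma mem_Dk x : (x \in fset_set (Dk D k)) = `[< Dk D k x >].
Proof. by rewrite in_fset_set //; exact: finite_Dk. Qed.

Lemma edistC (x y : 'rV[R]_n) : edist x y = edist y x.
Proof. by rewrite /edist; under eq_bigr do rewrite -sqrrN opprB. Qed.

Lemma adjC x y : adj D k x y -> adj D k y x.
Proof. by move=> [Dx Dy xy]; split=> //; rewrite edistC. Qed.

Lemma edist_coord (x y : 'rV[R]_n) i : `|x ord0 i - y ord0 i| <= edist x y.
Proof.
rewrite -sqrtr_sqr; apply: ler_wsqrtr.
by rewrite (bigD1 i) //= lerDl sumr_ge0 // => j _; exact: sqr_ge0.
Qed.

(** Neighbours at Euclidean distance 2^-k lie in a cube of 3^n lattice points. This is cruder than 2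
    n, but what matters is a bound independent of k. *)
Lemma deg_le x : (deg D k x <= 3 ^ n)%N.
Proof.
rewrite /deg; have [[y [[_ [z xz]] _ _]]|noadj] := pselect (exists y,
  adj D k x y).
  suff /lattice_box_card[] : forall y, adj D k x y ->
      exists2 z' : 'rV[int]_n, y = 2 ^- k *: map_mx intr z' &
        forall i, (absz (z' ord0 i - z ord0 i)%R <= 1)%N by [].
  move=> {}y.
  move=> [_ [_ [z' yz]] xy]; exists z' => // i.
  have := edist_coord x y i; rewrite xy xz yz !mxE -mulrBr normrM gtr0_norm //.
  rewrite -[leRHS]mulr1 ler_pM2l // -intrB -intr_norm -abszE -pmulrn (ler_nat _
    _ 1).
  by rewrite -abszN opprB.
by rewrite (_ : mkset _ = set0) ?fset_set0 // -subset0 => y h; apply: noadj;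
  exists y.
Qed.

Lemma finite_adj x : finite_set [set y | adj D k x y].
Proof. by apply: sub_finite_set finite_Dk => y []. Qed.

Lemma deg_gt0 x y : adj D k x y -> (0 < deg D k x)%N.
Proof.
move=> xy; rewrite /deg cardfs_gt0; apply/fset0Pn; exists y.
by rewrite in_fset_set ?inE //; exact: finite_adj.
Qed.

Lemma mk_mass_ge0 x : 0 <= mk_mass D k x.
Proof. by rewrite mulr_ge0 ?divr_ge0 // invr_ge0 exprn_ge0. Qed.

Lemma jump_prob_ge0 x y : 0 <= jump_prob D k x y.
Proof. by rewrite /jump_prob; case: ifP => _; rewrite ?divr_ge0. Qed.

Lemma sum_jump_prob x : Dk D k x ->
  \sum_(y <- fset_set (Dk D k)) jump_prob D k x y = 1.
Proof.
move=> Dx; rewrite /jump_prob; have [deg0|deg_neq0] := eqVneq (deg D k x) 0%N.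
  rewrite (bigD1_seq x) ?fset_uniq ?mem_Dk ?asboolT //= eqxx big1 ?addr0 // =>
    y yx.
  by rewrite eq_sym (negbTE yx).
rewrite -mulr_suml.
have -> : \sum_(y <- fset_set (Dk D k))
  (`[< adj D k x y >])%:R = (deg D k x)%:R :> R.
  rewrite -natr_sum; congr (_%:R).
  rewrite (eq_bigr (fun y => if `[< adj D k x y >] then 1 else 0)%N);
    last first.
    by move=> y _; case: `[< _ >].
  rewrite -big_mkcond -big_filter /deg card_fset_sum1 big_seq_fsetE /=.
  rewrite -(big_seq_fsetE _ _ xpredT (fun=> 1%N)) /=.
  apply: perm_big; apply: uniq_perm; rewrite ?filter_uniq ?fset_uniq // => y.
  rewrite mem_filter mem_Dk in_fset_set; last exact: finite_adj.
  rewrite /in_mem /=; apply/andP/idP => [[/asboolP h _]|/asboolP h].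
    by apply/asboolP.
  by split; apply/asboolP => //; case: h.
by rewrite divff // pnatr_eq0.
Qed.

(** The degree cancels, leaving a symmetric weight on edges. An isolated vertex jumps to itself, but
    its mass is 0. *)
Lemma jump_prob_reversible x y :
  mk_mass D k x * jump_prob D k x y = mk_mass D k y * jump_prob D k y x.
Proof.
have key u v : mk_mass D k u * jump_prob D k u v =
    (`[< adj D k u v >])%:R * ((2 * n)%:R^-1 * 2 ^- (k * n)).
  rewrite /mk_mass /jump_prob; have [deg0|deg_neq0] := eqVneq (deg D k u) 0%N.
    rewrite deg0 !mul0r asboolF ?mul0r // => /deg_gt0.
    by rewrite deg0.
  have : (deg D k u)%:R != 0 :> R by rewrite pnatr_eq0.
  by move: ((2 * n)%:R^-1) (2 ^- (k * n)) => a b hd; field.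
rewrite !key; congr (_%:R * _); congr (nat_of_bool _).
by apply/asboolP/asboolP; exact: adjC.
Qed.

Lemma jump_prob_near x y i : jump_prob D k x y != 0 ->
  `|x ord0 i - y ord0 i| <= 2 ^- k.
Proof.
rewrite /jump_prob; case: ifP => _.
  case: (x =P y) => [-> _|_]; last by rewrite eqxx.
  by rewrite subrr normr0 (ltW c0).
case: asboolP => [[_ _ <-] _|_]; first exact: edist_coord.
by rewrite mul0r eqxx.
Qed.

(** Uniform in k: the weight 2^-(kn) of a vertex compensates the at most ((2 B + 1) 2^k)^n
    vertices. *)
Lemma total_mass_le :
  \sum_(x <- fset_set (Dk D k)) mk_mass D k x <= (3 ^ n * (2 * B + 1) ^ n)%:R.
Proof.
have hx x : mk_mass D k x <= (3 ^ n)%:R * 2 ^- (k * n).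
  rewrite ler_pM2r ?invr_gt0 ?exprn_gt0 //.
  have [n0|n_gt0] := posnP n.
    (* In dimension 0 the quotient is 0, because division by 0 yields 0. *)
    have e0 : (2 * n)%:R = 0 :> R by rewrite n0 muln0.
    by rewrite e0 invr0 mulr0.
  rewrite ler_pdivrMr ?ltr0n ?muln_gt0 // -natrM ler_nat.
  by rewrite (leq_trans (deg_le _)) // leq_pmulr // muln_gt0.
apply: (@le_trans _ _ (\sum_(x <- fset_set (Dk D k))
  ((3 ^ n)%:R * 2 ^- (k * n)))).
  by apply: ler_sum => x _; exact: hx.
rewrite big_const_seq count_predT iter_addr_0 -[leLHS]mulr_natl.
rewrite natrM mulrCA ler_pM2l ?ltr0n ?expn_gt0 //.
rewrite ler_pdivrMr ?exprn_gt0 // -natrX -natrM ler_nat.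
apply: leq_trans Dk_card.2 _.
rewrite expnM -expnMn; have [->//|n_gt0] := posnP n; rewrite leq_exp2r //.
by rewrite mulnDl mul1n mulnA -addn1 leq_add2l expn_gt0.
Qed.

End lattice_walk.

(** * Exponential holding times *)

Lemma exponential_law (R : realType) (rate : R) : 0 < rate ->
  exists E : probability (measurableTypeR R) R,
    [/\ forall A, E A = exponential_prob rate A,
        forall a b, a <= b -> (E `[a, b]%classic <= (rate * (b - a))%:E)%E &
        E `]-oo, 0%R[%classic = 0%E].
Proof.
move=> r0; unshelve eexists (exponential_prob rate : probability _ _);
  first exact: r0.
split=> //.
- move=> a b ab.
  apply: (@le_trans _ _ (\int[lebesgue_measure]_(x in `[a, b]%classic)
    (cst rate%:E x))%E).
    apply: ge0_le_integral => //.
    + by move=> x _; rewrite lee_fin exponential_pdf_ge0 // ltW.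
    + apply/measurable_EFinP; apply: measurable_funTS.
      exact: measurable_exponential_pdf.
    + move=> x _; rewrite lee_fin.
      have [x0|x0] := ltP x 0; first by rewrite lt0_exponential_pdf // ltW.
      rewrite exponential_pdfE // ger_pMr // -expR0 ler_expR mulNr oppr_le0.
      by rewrite mulr_ge0 // ltW.
  rewrite integral_cst //= lebesgue_measure_itv /= lte_fin.
  by case: ifP => _; rewrite ?mule0 ?lee_fin ?mulr_ge0 ?subr_ge0 // ltW.
- rewrite /= /exponential_prob integral0_eq // => x.
  by rewrite /= in_itv /= => x0; rewrite lt0_exponential_pdf.
Qed.

Section holding_times.
Context (R : realType) d (Omega : measurableType d).
Variable P : {measure set Omega -> \bar R}.
Variable E : probability (measurableTypeR R) R.
Variables (rate Mass : R).
Hypotheses (rate0 : 0 <= rate) (Mass0 : 0 <= Mass).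
Hypothesis E_itv : forall a b, a <= b -> (E `[a,
  b]%classic <= (rate * (b - a))%:E)%E.
Hypothesis E_neg : E `]-oo, 0%R[%classic = 0%E.

Let e (A : set R) : R := fine (E A).

Let eE (A : set R) : measurable A -> E A = (e A)%:E.
Proof. by move=> mA; rewrite fineK // fin_num_measure. Qed.

Let e0 A : 0 <= e A. Proof. by rewrite fine_ge0. Qed.

Let eT : e setT = 1. Proof. by rewrite /e probability_setT. Qed.

(** Independence in the form of product upper bounds; [Mass] absorbs the total mass of P. *)
Definition hold_le (H : nat -> Omega -> R) :=
  (forall j, measurable_fun setT (H j)) /\
  forall N (B : nat -> set R), (forall j, measurable (B j)) ->
    (P (\bigcap_(j < N) (H j @^-1` B j)) <=
       (Mass * \prod_(j < N) fine (E (B j)))%:E)%E.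

Lemma hold_le_shift H i : hold_le H -> hold_le (fun j => H (i + j)%N).
Proof.
move=> [mH HP]; split=> // N B mB.
pose B' j := if (j < i)%N then setT else B (j - i)%N.
have mB' j : measurable (B' j) by rewrite /B'; case: ifP.
have := HP (i + N)%N B' mB'; rewrite big_split_ord /= big1 ?mul1r; last first.
  by move=> j _; rewrite /B' ltn_ord; exact: eT.
under eq_bigr do rewrite /B' ltnNge leq_addr /= addKn.
apply: le_trans; apply: le_measure; rewrite ?inE.
- apply: bigcap_measurableType => // j _; rewrite -[_ @^-1` _]setTI.
  exact: mH.
- by apply: bigcap_measurableType => // j _; rewrite -[_ @^-1` _]setTI;
  exact: mH.
- move=> w hw j /= jl; rewrite /B'; case: ltnP => // ij.
  by have := hw (j - i)%N; rewrite /= subnKC //; apply; rewrite ltn_subLR.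
Qed.

Lemma measurable_hold (H : nat -> Omega -> R) j (B : set R)
  : hold_le H -> measurable B ->
  measurable (H j @^-1` B).
Proof. by move=> [mH _] mB; rewrite -[_ @^-1` _]setTI; exact: mH. Qed.

Lemma hold_le1 H j (B : set R) : hold_le H -> measurable B ->
  (P (H j @^-1` B) <= (Mass * e B)%:E)%E.
Proof.
move=> HH mB; have [_ h] := hold_le_shift j HH.
have := h 1%N (fun=> B) (fun=> mB); rewrite big_ord1; apply: le_trans.
apply: le_measure; rewrite ?inE; first exact: measurable_hold.
  by apply: bigcap_measurableType => // i _; exact: measurable_hold.
by move=> w hw [|i] //= _; rewrite /= addn0.
Qed.

Lemma hold_neg H j : hold_le H -> P (H j @^-1` `]-oo, 0%R[%classic) = 0%E.
Proof.
move=> HH; apply/eqP; rewrite eq_le measure_ge0 andbT.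
by have := @hold_le1 H j `]-oo, 0%R[%classic HH; rewrite /e E_neg mulr0; apply.
Qed.

Lemma exp_lt_le (x : R) : 0 <= x -> e `]-oo, x[%classic <= rate * x.
Proof.
move=> x0; rewrite -lee_fin -eE //.
apply: (@le_trans _ _ (E (`]-oo, 0%R[%classic `|` `[0, x]%classic))).
  apply: le_measure; rewrite ?inE //; first exact: measurableU.
  move=> y /=; rewrite !in_itv /= => yx.
  by have [y0|y0] := ltP y 0; [left|right; apply/andP; split => //; exact: ltW].
apply: (@le_trans _ _ (E `]-oo, 0%R[%classic + E `[0%R, x]%classic)%E).
  exact: measureU2.
by rewrite E_neg add0e; have := E_itv x0; rewrite subr0.
Qed.

Lemma hold_small H j (x : R) : hold_le H -> 0 <= x ->
  (P (H j @^-1` `]-oo, x[%classic) <= (Mass * (rate * x))%:E)%E.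
Proof.
move=> HH x0; apply: le_trans (hold_le1 j HH _) _ => //.
by rewrite lee_fin ler_wpM2l // exp_lt_le.
Qed.

(* Chernoff: each holding time exceeds [x] with probability at least 1/2, and
   [2 * (3 / 4) ^ 4 = 81 / 128]. *)
Lemma hold_many (H : nat -> Omega -> R) (x : R) (h : nat) : hold_le H ->
  0 <= x -> rate * x <= 1 / 2 ->
  let A := [set w | (\sum_(j < 4 * h) (x <= H j w)%R < h)%N] in
  measurable A /\ (P A <= (Mass * (81 / 128) ^+ h)%:E)%E.
Proof.
move=> HH x0 rx A.
pose Z j w : bool := x <= H j w.
have mZ j b : measurable (Z j @^-1` [set b]).
  rewrite (_ : _ @^-1` _ = H j @^-1` (if b then `[x, +oo[%classic else `]-oo,
    x[%classic)).
    by case: b; exact: measurable_hold.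
  rewrite /Z eqEsubset; split=> w /=; case: b; rewrite /= in_itv /= ?andbT //.
    by move=> /negbT; rewrite -ltNge.
  by move=> h'; rewrite leNgt h'.
have Zvs j w : Z j w \in [:: true; false] by case: (Z j w).
have mA : measurable A.
  rewrite (_ : A = (fun w => \sum_(j < 4 * h) (Z j w)%:R : R) @^-1` `]-oo,
    h%:R[%classic).
    rewrite -[_ @^-1` _]setTI; apply: measurable_sum => // j.
    exact: (measurable_fun_finite_range (fun b : bool => b%:R : R) (Zvs j)
      (mZ j)).
  by rewrite eqEsubset; split=> w /=; rewrite in_itv /= -natr_sum ltr_nat.
split=> //.
pose p := e `[x, +oo[%classic.
have pq : e `]-oo, x[%classic = 1 - p.
  have : E setT = (e `[x, +oo[%classic + e `]-oo, x[%classic)%:E.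
    rewrite EFinD -!eE // -measureU //.
      by rewrite setUC -setCitvl setUv.
    by rewrite setIC -setCitvl setICr.
  by rewrite probability_setT => -[->]; rewrite /p addrAC subrr add0r.
have p2 : 1 / 2 <= p by have := exp_lt_le x0; lra.
pose w (b : bool) : R := if b then p else 1 - p.
have w0 b : 0 <= w b by rewrite /w; case: b; [rewrite e0|rewrite -pq e0].
(* On the event, 2^h / 2^(number of long holding times) is at least 1, and one more trial multiplies
   it on average by 1 - p / 2 <= 3/4. The last factor accounts in advance for the 4 h - l trials to
   come. *)
pose G l (y : nat -> bool) : R := Mass * (\prod_(j < l) w (y j)) *
   (2 ^+ h / 2 ^+ (\sum_(j < l) y j) * (3 / 4) ^+ (4 * h - l)).
suff : (P A <= (G 0%N (fun=> true))%:E)%E.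
  rewrite /G !big_ord0 mulr1 expr0 divr1 subn0 exprM -exprMn.
  by rewrite (_ : 2 * (3 / 4) ^+ 4 = 81 / 128 :> R) //; field.
apply: (@ville _ _ _ _ _ [:: true;
  false] Z A (4 * h)%N G (fun _ _ => True)) => //.
- move=> l y lm _; right; split=> //.
  rewrite big_cons big_seq1 /G !big_ord_recr /=.
  have ue z : \prod_(j < l) w (upd y l z j) = \prod_(j < l) w (y j).
    by apply: eq_bigr => j _; rewrite upd_lt.
  have us z : (\sum_(j < l) upd y l z j = \sum_(j < l) y j)%N.
    by apply: eq_bigr => j _; rewrite upd_lt.
  rewrite !ue !us !updE addn1 addn0.
  have -> : (4 * h - l = (4 * h - l.+1).+1)%N by rewrite subnSK.
  rewrite /w exprS exprS invfM.
  have M0 : 0 <= Mass * (\prod_(j < l) w (y j)) * (2 ^+ h / 2 ^+ (\sum_(j < l)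
    y j) * (3 / 4) ^+ (4 * h - l.+1)).
    by rewrite !mulr_ge0 ?prodr_ge0 ?invr_ge0 ?exprn_ge0.
  move: M0; set a := \prod_(j < l) _; set b := 2 ^+ h; set s := (_ ^+ _)^-1.
  set t := (_ ^+ _) => M0.
  have -> : Mass * (a * p) * (b * (2^-1 * s) * t) + Mass * (a * (1 - p))
    * (b * s * t) =
    (1 - p / 2) * (Mass * a * (b * s * t)) by field.
  have -> : Mass * a * (b * s * (3 / 4 * t)) = 3 / 4 * (Mass * a * (b * s * t))
    by ring.
  by apply: ler_wpM2r => //; lra.
- move=> y _.
  have [s|s] := leqP h (\sum_(j < 4 * h) y j)%N.
    rewrite (_ : _ `&` _ = set0) ?measure0 ?lee_fin.
      by rewrite /G !mulr_ge0 ?prodr_ge0 ?invr_ge0 ?exprn_ge0.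
    rewrite -subset0 => w' [cw]; rewrite /A /=.
    rewrite (eq_bigr (fun j : 'I_(4 * h) => y j : nat)) => [|j _];
      first by rewrite ltnNge s.
    by rewrite -(cw j (ltn_ord j)).
  apply: (@le_trans _ _ (Mass * \prod_(j < 4 * h) w (y j))%:E); last first.
    rewrite lee_fin /G subnn mulr1 ler_peMr ?mulr_ge0 ?prodr_ge0 //.
    by rewrite ler_pdivlMr ?exprn_gt0 // mul1r ler_eXn2l ?ltr1n // ltnW.
  have [_ HP] := HH.
  pose B j : set R := if y j then `[x, +oo[%classic else `]-oo, x[%classic.
  have mB j : measurable (B j) by rewrite /B; case: (y j).
  have := HP (4 * h)%N B mB.
  rewrite (eq_bigr (fun j : 'I_(4 * h) => w (y j))) => [|j _]; last first.
    by rewrite /w /B; case: (y j).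
  apply: le_trans; apply: le_measure; rewrite ?inE.
  - by apply: measurableI => //; exact: measurable_cyl.
  - by apply: bigcap_measurableType => // j _; exact: measurable_hold.
  - move=> w' [cw _] j jl; have /= := cw j jl; rewrite /Z /B => <-.
    have [xH|Hx] := boolP (x <= H j w'); rewrite /= in_itv /= ?xH //.
    by rewrite ltNge.
Qed.

(* The event is covered by cells of side [x]: given the cells of the first [j]
   holding times, the last one has to lie in an interval of length [j.+1 * x].
   *)
Lemma hold_sum_window (H : nat -> Omega -> R) (T x : R) (j : nat) : hold_le H ->
  0 < x -> 0 <= T ->
  let A := [set w | (forall i, (i <= j)%N -> 0 <= H i w) /\
                    T - x < \sum_(i < j.+1) H i w <= T] in
  measurable A /\ (P A <= (Mass * (rate * (j.+1%:R * x)))%:E)%E.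
Proof.
move=> HH x0 T0 A; have [mH HP] := HH.
have mA : measurable A.
  rewrite (_ : A = \bigcap_(i < j.+1) (H i @^-1` `[0, +oo[%classic) `&`
     ((fun w => \sum_(i < j.+1) H i w) @^-1` `]T - x, T]%classic)); last first.
    rewrite eqEsubset; split=> w [h1 h2]; (split; last by move: h2;
      rewrite /= in_itv).
      by move=> i /= ij; rewrite in_itv /= h1.
    by move=> i ij; have := h1 i ij; rewrite /= in_itv /= andbT.
  apply: measurableI.
    by apply: bigcap_measurableType => // i _; exact: measurable_hold.
  rewrite -[_ @^-1` _]setTI; apply: measurable_sum => //.
split => //.
pose L := Num.truncn (T / x).
(* The cap leaves finitely many cells, as [ville] requires. On the event every holding time is at
   most T, so its index is at most L and the cap is not reached. *)
pose cell (u : R) : nat := minn (Num.truncn (u / x)) L.+1.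
have mcell a : measurable (cell @^-1` [set a]).
  have mge b : measurable [set u | (b <= cell u)%N].
    case: b => [|b]; first by rewrite (_ : mkset _ = setT) // eqEsubset; split.
    have [bL|Lb] := leqP b L; last first.
      rewrite (_ : mkset _ = set0) // -subset0 => u /=.
      by rewrite /cell leq_min !ltnS andbC leqNgt Lb.
    rewrite (_ : mkset _ = `[b.+1%:R * x, +oo[%classic) // eqEsubset.
    split=> u /=; rewrite /cell in_itv /= andbT leq_min !ltnS bL andbT.
      move=> bu; rewrite -ler_pdivlMr //.
      have u0 : 0 <= u / x.
        by apply: le_trans ler01 _; rewrite -truncn_gt0 (leq_trans _ bu).
      by rewrite -truncn_ge_nat.
    move=> bu; have u0 : 0 <= u / x.
      by rewrite divr_ge0 ?(ltW x0) // (le_trans _ bu) // mulr_ge0 ?(ltW x0).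
    by rewrite truncn_ge_nat // ler_pdivlMr.
  rewrite (_ : _ @^-1` _ = [set u | (a <= cell u)%N] `\` [set u | (a.+1 <= cell
    u)%N]).
    exact: measurableD.
  rewrite eqEsubset; split=> u /=; first by move=> ->; rewrite leqnn ltnn.
  by move=> [h1 /negP h2]; apply/eqP; rewrite eqn_leq h1 leqNgt h2.
pose vs := iota 0 L.+2.
have cellvs u : cell u \in vs by rewrite mem_iota /= add0n ltnS geq_minr.
pose Z i w := cell (H i w).
have sum_cell : \sum_(a <- vs) e (cell @^-1` [set a]) <= 1.
  rewrite -lee_fin -sumEFin -(@probability_setT _ _ _ E).
  under eq_bigr do rewrite -eE //.
  rewrite (_ : vs = index_iota 0 L.+2) ?big_mkord;
    last by rewrite /index_iota subn0.
  have mcells : measurable (\big[setU/set0]_(a < L.+2)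
    (cell @^-1` [set val a])).
    by apply: bigsetU_measurable => a _; exact: mcell.
  have tcells : trivIset setT (fun a : 'I_L.+2 => cell @^-1` [set val a]).
    by move=> a b _ _ [u [/= ua ub]]; apply: val_inj; rewrite /= -ua -ub.
  have <- := measure_semi_additive_ord E (fun a => mcell (val a)) tcells mcells.
  by apply: le_measure; rewrite ?inE.
pose G l (y : nat -> nat) : R :=
  Mass * (\prod_(i < l) e (cell @^-1` [set y i])) * (rate * (j.+1%:R * x)).
have G0 l y : 0 <= G l y.
  by rewrite !mulr_ge0 ?prodr_ge0 ?(ltW x0).
suff : (P A <= (G 0%N (fun=> 0%N))%:E)%E by rewrite /G big_ord0 mulr1.
apply: (@ville _ _ _ _ _ vs Z A j G (fun _ _ => True)) => //.
- by move=> i w; exact: cellvs.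
- by move=> i a; exact: measurable_hold (mcell a).
- move=> l y lj _; right; split=> //; rewrite /G.
  under eq_bigr => z _.
    rewrite big_ord_recr /= updE.
    rewrite (eq_bigr (fun i : 'I_l => e (cell @^-1` [set y i]))) => [|i _];
      last first.
      by rewrite upd_lt.
    over.
  rewrite -mulr_suml -mulr_sumr -mulr_sumr; apply: ler_wpM2r.
    by rewrite !mulr_ge0 ?(ltW x0).
  by rewrite mulrA ler_piMr // mulr_ge0 // prodr_ge0.
move=> y _; pose J : set R :=
  `[T - x - \sum_(i < j) (y i).+1%:R * x, T - \sum_(i < j)
    (y i)%:R * x]%classic.
have mJ : measurable J by rewrite /J; exact: measurable_itv.
have Jlen : T - \sum_(i < j) (y i)%:R * x - (T - x - \sum_(i < j)
  (y i).+1%:R * x) =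
    j.+1%:R * x.
  under [X in _ - (_ - X)]eq_bigr do rewrite -natr1 mulrDl mul1r.
  rewrite big_split /= sumr_const card_ord -natr1 mulrDl mul1r mulr_natl; ring.
have EJ : e J <= rate * (j.+1%:R * x).
  rewrite -lee_fin -eE // -Jlen; apply: E_itv; rewrite -subr_ge0 Jlen.
  by rewrite mulr_ge0 // ltW.
pose B i : set R := if (i < j)%N then cell @^-1` [set y i] else J.
have mB i : measurable (B i) by rewrite /B; case: ifP.
have BJ : B j = J by rewrite /B ltnn.
have := HP j.+1 B mB; rewrite big_ord_recr /= BJ => HPB.
apply: (@le_trans _ _ (Mass * (\prod_(i < j) e (cell @^-1` [set y i])
  * e J))%:E).
  move: HPB; rewrite (eq_bigr (fun i : 'I_j => e (cell @^-1` [set y i])))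
    => [|i _]; last first.
    by rewrite /B ltn_ord.
  apply: le_trans; apply: le_measure; rewrite ?inE.
  - by apply: measurableI => //; apply: measurable_cyl => i a _;
    exact: measurable_hold (mcell a).
  - by apply: bigcap_measurableType => // i _; exact: measurable_hold.
  move=> w [cw [Hpos /andP[hT1 hT2]]] i /=; rewrite ltnS /B.
  have [ij|ji] := ltnP i j; first by move=> _; exact: cw.
  move=> ij; have {ij ji} -> : i = j by apply/eqP; rewrite eqn_leq ij.
  have HT i' : (i' <= j)%N -> H i' w <= T.
    move=> ij; apply: le_trans hT2.
    rewrite (bigD1 (Ordinal (ij : (i' < j.+1)%N))) //= lerDl.
    by apply: sumr_ge0 => i'' _; apply: Hpos; rewrite -ltnS.
  have yb (i' : 'I_j) : (y i')%:R * x <= H i' w <= (y i').+1%:R * x.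
    have ij := ltnW (ltn_ord i').
    have Hx0 : 0 <= H i' w / x by rewrite divr_ge0 ?Hpos // ltW.
    have -> : y i' = Num.truncn (H i' w / x).
      rewrite -(cw i' (ltn_ord i')) /Z /cell; apply/minn_idPl.
      rewrite (@leq_trans L) // /L; apply: le_truncn.
      by rewrite ler_pM2r ?invr_gt0 // HT.
    have /andP[h1 h2] := truncn_itv Hx0.
    by rewrite -ler_pdivlMr // h1 -ler_pdivrMr // ltW.
  have s1 : \sum_(i < j) (y i)%:R * x <= \sum_(i < j) H i w.
    by apply: ler_sum => i' _; have /andP[] := yb i'.
  have s2 : \sum_(i < j) H i w <= \sum_(i < j) (y i).+1%:R * x.
    by apply: ler_sum => i' _; have /andP[] := yb i'.
  move: hT1 hT2; rewrite big_ord_recr /= /J /= in_itv /= => hT1 hT2.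
  by apply/andP; split; lra.
rewrite lee_fin /G -!mulrA; apply: ler_wpM2l => //; apply: ler_wpM2l => //.
by rewrite prodr_ge0.
Qed.

End holding_times.

(** * From the chain to its continuous-time path *)

Section exceptional.
Context (R : realType) d (Omega : measurableType d).
Variable P : {measure set Omega -> \bar R}.

(** A measurable exceptional set stands in for the complement of Q, because properties quantified
    over all times come without a proof of measurability. *)
Definition exceptional (b : R) (Q : Omega -> Prop) :=
  exists N : set Omega, [/\ measurable N, (P N <= b%:E)%E & forall w,
    ~ N w -> Q w].

Lemma exceptionalW b b' (Q Q' : Omega -> Prop) : b <= b' -> (forall w,
  Q w -> Q' w) ->
  exceptional b Q -> exceptional b' Q'.
Proof.
move=> bb' QQ' [N [mN PN hN]]; exists N; split=> // [|w /hN/QQ'//].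
by apply: le_trans PN _; rewrite lee_fin.
Qed.

Lemma exceptionalI b b' (Q Q' : Omega -> Prop) : exceptional b Q ->
  exceptional b' Q' -> exceptional (b + b') (fun w => Q w /\ Q' w).
Proof.
move=> [N [mN PN hN]] [N' [mN' PN' hN']]; exists (N `|` N'); split.
- exact: measurableU.
- by rewrite EFinD; apply: le_trans (measureU2 _ _ _) (leeD PN PN').
- by move=> w /not_orP[/hN ? /hN' ?].
Qed.

Lemma exceptional_sum (r : nat) (b : nat -> R) (Q : nat -> Omega -> Prop) :
  (forall i, (i < r)%N -> exceptional (b i) (Q i)) ->
  exceptional (\sum_(i < r) b i) (fun w => forall i, (i < r)%N -> Q i w).
Proof.
elim: r => [|r IH] hQ.
  by rewrite big_ord0; exists set0; split=> //; rewrite measure0.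
have {}IH := IH (fun i ir => hQ i (ltnW ir)).
apply: exceptionalW (exceptionalI IH (hQ r (ltnSn r))).
  by rewrite big_ord_recr.
by move=> w [h1 h2] i; rewrite ltnS leq_eqVlt => /orP[/eqP ->|/h1].
Qed.

Lemma exceptional_forall (r : nat) (b : R) (Q : nat -> Omega -> Prop) :
  (forall i, (i < r)%N -> exceptional b (Q i)) ->
  exceptional (r%:R * b) (fun w => forall i, (i < r)%N -> Q i w).
Proof. by move=> /exceptional_sum; rewrite sumr_const card_ord mulr_natl. Qed.

End exceptional.

(** * Deterministic facts about jump times *)

Section jump_times.
Context (R : realType).
Variable h : nat -> R.

Definition jump_time j : R := \sum_(i < j) h i.

Lemma jump_timeD a b : jump_time (a + b) = jump_time a + \sum_(i < b)
  h (a + i)%N.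
Proof. by rewrite /jump_time big_split_ord. Qed.

Lemma jump_timeS j : jump_time j.+1 = jump_time j + h j.
Proof. by rewrite /jump_time big_ord_recr. Qed.

Hypothesis h0 : forall j, 0 <= h j.

Lemma jump_time_le a b : (a <= b)%N -> jump_time a <= jump_time b.
Proof. by move=> /subnKC <-; rewrite jump_timeD lerDl sumr_ge0. Qed.

Lemma jump_time_ltW a b : jump_time a < jump_time b -> (a < b)%N.
Proof. by move=> ab; rewrite ltnNge; apply/negP => /jump_time_le;
  rewrite leNgt ab. Qed.

Lemma jump_time_locate t M : 0 <= t -> t < jump_time M ->
  exists2 j, (j < M)%N & jump_time j <= t < jump_time j.+1.
Proof.
move=> t0 tM; have ex : exists j, t < jump_time j.+1.
  case: M tM => [|M] tM; last by exists M.
  by move: tM; rewrite /jump_time big_ord0 ltNge t0.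
case: (ex_minnP ex) => j tj jmin; exists j; last first.
  rewrite tj andbT; case: j jmin {tj} => [|j] jmin;
    first by rewrite /jump_time big_ord0.
  by rewrite leNgt; apply/negP => /jmin; rewrite ltnn.
case: M tM => [|M] tM; last by rewrite ltnS jmin.
by move: tM; rewrite /jump_time big_ord0 ltNge t0.
Qed.

(** Two times less than dl apart lie in the same block or in adjacent ones, since a full block
    between them would last at least dl. The positions then differ by at most three oscillations
    over single blocks. The Q blocks outlast T. *)
Lemma block_modulus (y : nat -> R) (m Q : nat) (dl T rho : R) : (0 < m)%N ->
  (forall b, (b < Q)%N -> dl <= \sum_(j < m) h (b * m + j)%N) ->
  T < Q%:R * dl ->
  (forall b, (b < Q)%N -> forall j, (j <= m)%N ->
     `|y (b * m + j)%N - y (b * m)%N| <= rho) ->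
  forall s t i j, s <= T -> t <= T -> `|s - t| < dl ->
    jump_time i <= s < jump_time i.+1 -> jump_time j <= t < jump_time j.+1 ->
    `|y i - y j| <= 3 * rho.
Proof.
move=> m0 blk TQ osc s t.
wlog st : s t / s <= t => [hw i j sT tT dst si tj|].
  have [st|/ltW ts] := leP s t; first exact: (hw s t).
  by rewrite distrC; apply: (hw t s) => //; rewrite distrC.
move=> i j sT tT dst /andP[is1 is2] /andP[jt1 jt2].
have SQ b : (b <= Q)%N -> b%:R * dl <= jump_time (b * m).
  elim: b => [|b IH] bQ; first by rewrite mul0r mul0n /jump_time big_ord0.
  rewrite mulSn addnC jump_timeD -natr1 mulrDl mul1r.
  by apply: lerD; [exact: IH (ltnW bQ)|exact: blk].
have ij : (i <= j)%N by rewrite -ltnS; apply: jump_time_ltW;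
  exact: le_lt_trans (le_trans is1 st) jt2.
have jQ : (j < Q * m)%N.
  by apply: jump_time_ltW;
    apply: le_lt_trans (le_trans jt1 tT) (lt_le_trans TQ (SQ _ (leqnn Q))).
pose bi := (i %/ m)%N; pose bj := (j %/ m)%N.
have bij : (bi <= bj)%N by exact: leq_div2r.
have bjQ : (bj < Q)%N by rewrite ltn_divLR.
have iE : i = (bi * m + i %% m)%N by exact: divn_eq.
have jE : j = (bj * m + j %% m)%N by exact: divn_eq.
have im : (i %% m < m)%N by rewrite ltn_mod.
have jm : (j %% m < m)%N by rewrite ltn_mod.
have close : (bj <= bi.+1)%N.
  rewrite leqNgt; apply/negP => far.
  have e1 : jump_time i.+1 <= jump_time (bi.+1 * m).
    by apply: jump_time_le; rewrite mulSn {1}iE addnC -addSn leq_add2r.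
  have e2 : jump_time (bi.+2 * m) <= jump_time j.
    by apply: jump_time_le;
      rewrite (leq_trans _ (leq_trunc_div j m)) // leq_mul2r far orbT.
  have e3 : jump_time (bi.+1 * m) + dl <= jump_time (bi.+2 * m).
    rewrite [(bi.+2 * m)%N]mulSn addnC jump_timeD lerD2l; apply: blk.
    by rewrite (leq_trans far) // ltnW.
  by move: dst; rewrite distrC ger0_norm ?subr_ge0 //; lra.
have o1 := osc bj bjQ (j %% m)%N (ltnW jm); rewrite -jE in o1.
have o2 := osc bi (leq_ltn_trans bij bjQ) (i %% m)%N (ltnW im);
  rewrite -iE in o2.
have rho0 : 0 <= rho by apply: le_trans o1.
move: o1 o2; move: close; rewrite leq_eqVlt => /orP[/eqP bE|]; last first.
  rewrite ltnS => close; have -> : bj = bi by apply/eqP; rewrite eqn_leq close.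
  rewrite !ler_norml => /andP[? ?] /andP[? ?]; apply/andP; split; lra.
have o3 := osc bi (leq_ltn_trans bij bjQ) m (leqnn m).
move: o3; rewrite bE mulSn addnC.
rewrite !ler_norml => /andP[? ?] /andP[? ?] /andP[? ?]; apply/andP; split; lra.
Qed.

End jump_times.

(** * Uniform estimates for the random walks *)

Lemma geometric_lt (R : realType) (z C e : R) : 0 <= z < 1 -> 0 <= C -> 0 < e ->
  exists N, forall h, (N <= h)%N -> C * z ^+ h < e.
Proof.
move=> /andP[z0 z1] C0 e0.
have eC : 0 < e / (C + 1) by rewrite divr_gt0 // ltr_wpDl.
have : (fun h => z ^+ h) @ \oo --> (0 : R).
  by apply: cvg_expr; rewrite ger0_norm.
move=> /cvgrPdist_lt /(_ _ eC) [N _ hN]; exists N => h Nh.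
have := hN h Nh; rewrite /= sub0r normrN ger0_norm ?exprn_ge0 //.
rewrite ltr_pdivlMr ?ltr_wpDl // => hz.
apply: le_lt_trans hz; rewrite mulrC ler_wpM2l ?exprn_ge0 //; lra.
Qed.

Section walk_estimates.
Context (R : realType) (n : nat) (D : set 'rV[R]_n) (B : nat).
Hypothesis DB : forall x, D x -> forall i, `|x ord0 i| <= B%:R.

Definition Mass : R := (3 ^ n * (2 * B + 1) ^ n)%:R.

Section fixed_scale.
Context (k : nat) d (Omega : measurableType d).
Context (P : {measure set Omega -> \bar R}) (Y : nat -> Omega -> 'rV[R]_n)
  (H : nat -> Omega -> R).
Hypothesis YH : jump_hold_chain D k P Y H.

Local Notation vs := (fset_set (Dk D k) : seq 'rV[R]_n).

Lemma walk_mem j w : Y j w \in vs.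
Proof. by case: YH => YD _ _ _; rewrite (mem_Dk _ DB); apply/asboolP. Qed.

Lemma walk_path_weight l y :
  (P (cyl Y l.+1 y) <= (path_weight (jump_prob D k) (mk_mass D k) l y)%:E)%E.
Proof.
case: YH => _ _ _ /(_ l y (fun=> setT) (fun=> measurableT)).
have r0 : 0 < 2 ^+ (2 * k) :> R by rewrite exprn_gt0.
have [E [EE _ _]] := exponential_law r0.
rewrite [X in (_ * X)%E]big1 ?mule1; last by move=> j _;
  rewrite -EE probability_setT.
rewrite (_ : \bigcap_(j < _) _ = cyl Y l.+1 y); last first.
  by apply: eq_bigcapr => j _; rewrite preimage_setT setIT.
by move=> ->.
Qed.

(** The positions are summed out of the joint law by [ville], without any stopping: transition
    probabilities sum to 1, and the initial masses to at most [Mass]. *)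
Lemma walk_hold_le (E : probability (measurableTypeR R) R) :
  (forall A, E A = exponential_prob (2 ^+ (2 * k)) A) -> hold_le P E Mass H.
Proof.
move=> EE; case: (YH) => YD mY mH PYH; split => // N.
have mHB (A : nat -> set R) M : (forall j, measurable (A j)) ->
    measurable (\bigcap_(j < M) (H j @^-1` A j)).
  by move=> mA; apply: bigcap_measurableType => // j _;
    rewrite -[_ @^-1` _]setTI; exact: mH.
have main M (A : nat -> set R) : (forall j, measurable (A j)) ->
    (P (\bigcap_(j < M.+1) (H j @^-1` A j)) <=
       (Mass * \prod_(j < M.+1) fine (E (A j)))%:E)%E.
  move=> mA; set e := \prod_(j < M.+1) _.
  have e0 : 0 <= e by apply: prodr_ge0 => j _; rewrite fine_ge0.
  pose G l (y : nat -> 'rV[R]_n) : R :=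
    (if l is l'.+1 then path_weight (jump_prob D k) (mk_mass D k)
      l' y else Mass) * e.
  apply: (@ville _ _ _ _ _ vs Y _ M.+1 G (fun l y => forall j,
    (j < l)%N -> y j \in vs)
            (fun=> 0)) => //.
  - by move=> j w; exact: walk_mem.
  - exact: mHB.
  - move=> l y lM yvs; right; split.
      move=> z zvs j; rewrite ltnS leq_eqVlt => /orP[/eqP ->|jl];
        first by rewrite updE.
      by rewrite upd_lt //; exact: yvs.
    rewrite /G; case: l lM yvs => [|l] lM yvs.
      rewrite -mulr_suml; apply: ler_wpM2r => //.
      under eq_bigr do rewrite /path_weight big_ord0 mulr1 updE.
      exact: (total_mass_le k DB).
    rewrite -mulr_suml; apply: ler_wpM2r => //.
    under eq_bigr => z _.
      rewrite /path_weight big_ord_recr /= updE.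
      rewrite (eq_bigr (fun j : 'I_l => jump_prob D k (y j) (y j.+1)))
        => [|j _]; last first.
        by rewrite !upd_lt ?ltnS ?ltn_ord // ltnW.
      rewrite !upd_lt // mulrA; over.
    have yl : Dk D k (y l).
      by have := yvs l (ltnSn l); rewrite (mem_Dk _ DB) => /asboolP.
    by rewrite -mulr_sumr (sum_jump_prob DB yl) mulr1.
  - move=> y _; rewrite /cyl -bigcapI PYH //.
    rewrite (_ : (\prod_(j < M.+1) exponential_prob (2 ^+ (2 * k))
      (A j))%E = e%:E).
      by rewrite -!EFinM.
    rewrite /e -prodEFin; apply: eq_bigr => j _; rewrite -EE fineK //.
    by rewrite fin_num_measure //; exact: mA.
(* With no holding time constrained, the bound is that of the total mass, read off from one holding
   time in the whole line. *)
case: N => [|N] A mA; last exact: main.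
have := main 0%N (fun=> setT) (fun=> measurableT).
rewrite big_ord0 big_ord1 probability_setT; apply: le_trans.
apply: le_measure; rewrite ?inE; [exact: mHB|exact: mHB|by move=> w _ j].
Qed.

Lemma walk_hold_ge0 : exceptional P 0 (fun w => forall j, 0 <= H j w).
Proof.
have r0 : 0 < 2 ^+ (2 * k) :> R by rewrite exprn_gt0.
have [E [EE Eitv Eneg]] := exponential_law r0; have HH := walk_hold_le EE.
have mN j : measurable (H j @^-1` `]-oo, 0%R[%classic).
  by apply: (measurable_hold (E := E) (Mass := Mass) (P := P)).
exists (\bigcup_j (H j @^-1` `]-oo, 0%R[%classic)); split.
- exact: bigcup_measurable.
- have mU : measurable (\bigcup_j (H j @^-1` `]-oo, 0%R[%classic)).
    exact: bigcup_measurable.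
  have : P.-negligible (\bigcup_j (H j @^-1` `]-oo, 0%R[%classic)).
    apply: negligible_bigcup => j; apply/negligibleP => //.
    exact: (hold_neg Eneg _ HH).
  by move=> /(negligibleP P mU) ->.
- move=> w hw j; rewrite leNgt; apply/negP => Hj; apply: hw.
  by exists j => //=; rewrite in_itv.
Qed.

Lemma mass_ge0 : 0 <= Mass. Proof. exact: ler0n. Qed.

Lemma hold_many_exceptional i0 h :
  exceptional P (Mass * (81 / 128) ^+ h) (fun w => (forall j, 0 <= H j w) ->
    h%:R * ((2 ^+ (2 * k))^-1 / 2) <= \sum_(j < 4 * h) H (i0 + j)%N w).
Proof.
have r0 : 0 < 2 ^+ (2 * k) :> R by rewrite exprn_gt0.
have [E [EE Eitv Eneg]] := exponential_law r0.
have HH := hold_le_shift i0 (walk_hold_le EE).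
(* Half the mean: one holding time is shorter with probability at most rate * x = 1/2. *)
set x := (2 ^+ (2 * k))^-1 / 2.
have x0 : 0 <= x by rewrite divr_ge0 ?invr_ge0 ?ltW.
have rx : 2 ^+ (2 * k) * x <= 1 / 2 by rewrite /x mulrA divff ?gt_eqF.
have [mA PA] := hold_many mass_ge0 Eitv Eneg h HH x0 rx.
move: mA PA; set A := [set w | _] => mA PA.
exists A; split=> // w nA Hw.
have {}nA : (h <= \sum_(j < 4 * h) (x <= H (i0 + j)%N w)%R)%N.
  by rewrite leqNgt; apply/negP.
apply: (@le_trans _ _ (\sum_(j < 4 * h) (x <= H (i0 + j)%N w)%R%:R * x)).
  by rewrite -mulr_suml -natr_sum ler_wpM2r // ler_nat.
by apply: ler_sum => j _; case: (leP x) => h'; rewrite ?mul1r ?mul0r.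
Qed.

Lemma block_osc_exceptional i0 m (l a : R) (i : 'I_n) : 0 <= l ->
  l * 2 ^- k <= 1 / 4 ->
  exceptional P (Mass * (4 * expR (m%:R * (8 * l ^+ 2 * (2 ^- k) ^+ 2)
    - l * a)))
    (fun w => forall j, (j <= m)%N ->
      `|Y (i0 + j)%N w ord0 i - Y i0 w ord0 i| <= 3 / 2 * a + 2 ^- k).
Proof.
move=> l0 lc; case: (YH) => YD mY _ _.
have qp y : \sum_(z <- vs) mk_mass D k z * jump_prob D k z y = mk_mass D k y.
  under eq_bigr do rewrite (jump_prob_reversible k DB).
  rewrite -mulr_sumr; have [Dy|nDy] := pselect (Dk D k y).
    by rewrite (sum_jump_prob DB Dy) mulr1.
  have -> : mk_mass D k y = 0; last by rewrite mul0r.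
  rewrite /mk_mass /deg (_ : mkset _ = set0) ?fset_set0 ?cardfs0 ?mul0r //.
  by rewrite -subset0 => z [].
have p1 x : x \in vs -> \sum_(z <- vs) jump_prob D k x z = 1.
  by rewrite (mem_Dk _ DB) => /asboolP; exact: (sum_jump_prob DB).
have c0 : 0 <= 2 ^- k :> R by rewrite invr_ge0 exprn_ge0.
have [N [mN PN hN]] := block_oscillation (f := fun x : 'rV[R]_n => x ord0 i)
  (@jump_prob_ge0 _ _ D k) (@mk_mass_ge0 _ _ D k) p1 qp
  (jump_prob_reversible k DB) c0
  (fun x y => @jump_prob_near _ _ D k x y i)
    walk_mem mY walk_path_weight i0 m a l0 lc.
exists N; split=> //; apply: le_trans PN _; rewrite lee_fin.
rewrite -mulr_suml; apply: ler_wpM2r; first by rewrite mulr_ge0 ?expR_ge0.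
exact: (total_mass_le k DB).
Qed.

(** A block has m = 4 * 4^r = 4^(k - q) jumps, and the exponential parameter is l = 2^q. The
    variance term m * 8 l^2 4^-k is then the constant 8, and l 2^-k = 1 / (2 * 2^r) is at most 1/4
    because r >= 1. Of the holding times, 4^r last at least 4^-k / 2, in total 1 / (8 * 4^q). *)
Lemma good_block (q r i0 : nat) (a : R) : k = (q.+1 + r)%N -> (0 < r)%N ->
  exceptional P (Mass * (81 / 128) ^+ (4 ^ r) +
      n%:R * (Mass * (4 * expR (8 - 2 ^+ q * a))))
    (fun w => (forall j, 0 <= H j w) ->
       (8 * 4 ^+ q)^-1 <= \sum_(j < 4 * 4 ^ r) H (i0 + j)%N w /\
       forall (i : 'I_n) j, (j <= 4 * 4 ^ r)%N ->
         `|Y (i0 + j)%N w ord0 i - Y i0 w ord0 i| <= 3 / 2 * a + 2 ^- k).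
Proof.
move=> kE r_gt0; have q0 : 2 ^+ q != 0 :> R by rewrite expf_neq0.
have r0 : 2 ^+ r != 0 :> R by rewrite expf_neq0.
have cE : 2 ^- k = (2 * 2 ^+ q * 2 ^+ r)^-1 :> R.
  by rewrite kE exprD exprS.
have pow4 s : 4 ^+ s = (2 ^+ s) ^+ 2 :> R.
  by rewrite -exprM mulnC exprM; congr (_ ^+ _); rewrite -natrX.
have xE : (4 ^ r)%:R * ((2 ^+ (2 * k))^-1 / 2) = (8 * 4 ^+ q)^-1 :> R.
  rewrite natrX mulnC exprM -[2 ^+ k]invrK cE !pow4; field.
  by apply/andP.
have mE : (4 * 4 ^ r)%:R * (8 * (2 ^+ q) ^+ 2 * (2 ^- k) ^+ 2) = 8 :> R.
  by rewrite natrM natrX cE pow4; field; apply/andP.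
apply: exceptionalW (exceptionalI (hold_many_exceptional i0 (4 ^ r))
  (@exceptional_forall _ _ _ P n _ (fun i w => forall (ltin : (i < n)%N) j,
     (j <= 4 * 4 ^ r)%N ->
     `|Y (i0 + j)%N w ord0 (Ordinal ltin) - Y i0 w ord0 (Ordinal ltin)|
        <= 3 / 2 * a + 2 ^- k) _)).
- exact: lexx.
- move=> w [h1 h2] Hw; split; first by rewrite -xE; exact: h1.
  by move=> [i' hi'] j; exact: h2.
- move=> i' hi'; apply: exceptionalW (@block_osc_exceptional i0 (4 * 4 ^ r)
  (2 ^+ q) a
     (Ordinal hi') _ _).
  + by rewrite mE.
  + move=> w h' ltin j jr; rewrite (_ : Ordinal ltin = Ordinal hi');
    first exact: h'.
    exact: val_inj.
  + by rewrite exprn_ge0.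
  + rewrite cE; have : 2 <= 2 ^+ r :> R.
      by rewrite -[leLHS]expr1 ler_eXn2l // ltr1n.
    have -> : 2 ^+ q * (2 * 2 ^+ q * 2 ^+ r)^-1 = (2 * 2 ^+ r)^-1 :> R.
      by field; apply/andP.
    move=> r2; rewrite ler_pdivlMr // -ler_pdivlMl ?invr_gt0 ?mulr_gt0
      ?exprn_gt0 //.
    by rewrite invrK mulr1; lra.
Qed.

End fixed_scale.
End walk_estimates.

Section uniform_estimates.
Context (R : realType) (n : nat) (D : set 'rV[R]_n) (B : nat).
Hypothesis DB : forall x, D x -> forall i, `|x ord0 i| <= B%:R.

Let M : R := Mass R n B.
Let M0 : 0 <= M. Proof. exact: ler0n. Qed.

(** From exp u >= (u / 3)^3. With y = 2^q the left side is the number of blocks, up to a constant,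
    times the error of one block, and the right side still decays like 2^-q. *)
Lemma sqr_expRN_le (a y : R) : 0 < a -> 0 < y ->
  y ^+ 2 * expR (- (y * a)) <= 27 / a ^+ 3 * y^-1.
Proof.
move=> a0 y0; have h : (y * a / 3) ^+ 3 <= expR (y * a).
  rewrite [X in expR X](_ : _ = 3%:R * (y * a / 3)); last by field.
  rewrite expRM_natl; apply: lerXn2r; rewrite ?nnegrE ?expR_ge0 //.
    by rewrite !mulr_ge0 // ltW.
  by apply: le_trans (expR_ge1Dx _); rewrite lerDr.
rewrite expRN ler_pdivrMr ?expR_gt0 //.
have ane : a != 0 by rewrite gt_eqF.
have yne : y != 0 by rewrite gt_eqF.
apply: (@le_trans _ _ (27 / a ^+ 3 * y^-1 * (y * a / 3) ^+ 3)).
  by rewrite le_eqVlt; apply/orP; left; apply/eqP; field; apply/andP.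
by apply: ler_wpM2l h; rewrite !mulr_ge0 ?invr_ge0 ?exprn_ge0 // ltW.
Qed.

Definition osc_at (T dl eps : R) (h : nat -> R) (y : nat -> 'rV[R]_n) :=
  forall s t i j, s <= T -> t <= T -> `|s - t| < dl ->
    jump_time h i <= s < jump_time h i.+1 ->
    jump_time h j <= t < jump_time h j.+1 ->
    forall c, `|y i ord0 c - y j ord0 c| < eps.

Lemma modulus_estimate (T eps eta : R) : 0 < T -> 0 < eps -> 0 < eta ->
  exists dl, 0 < dl /\ exists K : nat, forall k, (K <= k)%N ->
    forall d (Omega : measurableType d) (P : {measure set Omega -> \bar R}) Y H,
    jump_hold_chain D k P Y H ->
    exceptional P eta (fun w => (forall j, 0 <= H j w) ->
      osc_at T dl eps (H^~ w) (Y^~ w)).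
Proof.
(* Then 3 (3/2 a + 2^-k) = eps / 2 + 3 * 2^-k, which is below eps once 2^-k < eps / 6. *)
move=> T0 eps0 eta0; pose a := eps / 9.
have a0 : 0 < a by rewrite divr_gt0.
(* C 2^-q will bound the total oscillation error: at most (8 T + 1) 4^q blocks, n coordinates, and 4
   M exp (8 - 2^q a) for each. *)
pose C := (8 * T + 1) * (n%:R * (M * (4 * expR 8))) * (27 / a ^+ 3).
have C0 : 0 <= C.
  by rewrite !mulr_ge0 ?addr_ge0 ?mulr_ge0 ?expR_ge0 ?invr_ge0 ?exprn_ge0 //
    ltW.
have half : 0 <= (1 / 2 : R) < 1 by apply/andP; split; lra.
have eta2 : 0 < eta / 2 by rewrite divr_gt0.
(* q is fixed before k, and with it the block duration and the number Q of blocks. Hence Q is a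
   constant when K is chosen so that the holding-time error Q M (81/128)^(4^r) is small. *)
have [q /(_ q (leqnn q)) hq] := geometric_lt half C0 eta2.
pose Q := (Num.truncn (8 * 4 ^+ q * T)).+1.
have p4 : 1 <= 4 ^+ q :> R by rewrite exprn_ege1 // ler1n.
have fT0 : 0 <= 8 * 4 ^+ q * T by rewrite !mulr_ge0 ?exprn_ge0 // ltW.
have /andP[Q1 Q2] := truncn_itv fT0.
have QT : T < Q%:R * (8 * 4 ^+ q)^-1.
  rewrite ltr_pdivlMr ?mulr_gt0 ?exprn_gt0 //; apply: le_lt_trans Q2.
  by rewrite mulrC.
have Q4 : Q%:R <= (8 * T + 1) * 4 ^+ q.
  have -> : Q%:R = (Num.truncn (8 * 4 ^+ q * T))%:R + 1 :> R by rewrite natr1.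
  rewrite [leRHS]mulrDl mul1r; apply: lerD => //; apply: le_trans Q1 _.
  by rewrite mulrAC.
have c81 : 0 <= (81 / 128 : R) < 1 by apply/andP; split; lra.
have QM0 : 0 <= Q%:R * M by rewrite mulr_ge0.
have [N1 hN1] := geometric_lt c81 QM0 eta2.
have eps6 : 0 < eps / 6 by rewrite divr_gt0.
have [N2 hN2] := geometric_lt half ler01 eps6.
exists (8 * 4 ^+ q)^-1; split; first by rewrite invr_gt0 mulr_gt0 ?exprn_gt0.
exists (q.+1 + (N1 + N2).+1)%N => k Kk d Omega P Y H YH.
pose r := (k - q.+1)%N.
have kE : k = (q.+1 + r)%N by rewrite subnKC // (leq_trans _ Kk) // leq_addr.
have rN : (N1 + N2 < r)%N by rewrite ltn_subRL -addnS.
have r0 : (0 < r)%N by apply: leq_ltn_trans rN.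
have ck : 2 ^- k < eps / 6.
  have := hN2 k; rewrite !mul1r exprVn; apply.
  rewrite kE (leq_trans _ (leq_addl _ _)) // (leq_trans _ (ltnW rN)) //.
  exact: leq_addl.
have blocks := exceptional_forall (fun b (_ : (b < Q)%N) =>
  good_block DB YH (b * (4 * 4 ^ r))%N a kE r0).
apply: exceptionalW blocks.
  rewrite mulrDr [eta]splitr; apply: lerD.
    rewrite mulrA; apply/ltW/hN1;
      apply: leq_trans (ltnW (ltn_expl r (isT : (1 < 4)%N))).
    by apply: leq_trans (ltnW rN); rewrite leq_addr.
  apply: le_trans (ltW hq); rewrite /C.
  have E8 : expR (8 - 2 ^+ q * a) = expR 8 * expR (- (2 ^+ q * a))
    by rewrite expRD.
  have := sqr_expRN_le a0 (exprn_gt0 q (ltr0Sn R 1)); rewrite E8.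
  have -> : (2 ^+ q) ^+ 2 = 4 ^+ q :> R.
    by rewrite -exprM mulnC exprM; congr (_ ^+ _); rewrite -natrX.
  rewrite -[(2 ^+ q)^-1]exprVn => hexp;
    have -> : (1 / 2 : R) = 2^-1 by rewrite mul1r.
  set e := expR (- _) in hexp *; set X := n%:R * (M * (4 * expR 8)).
  have X0 : 0 <= X by rewrite !mulr_ge0 ?expR_ge0.
  have e0 : 0 <= e by exact: expR_ge0.
  apply: (@le_trans _ _ ((8 * T + 1) * 4 ^+ q * (X * e))).
    rewrite (_ : n%:R * _ = X * e); last by rewrite /X /M; ring.
    by apply: ler_wpM2r => //; rewrite mulr_ge0.
  have -> : (8 * T + 1) * 4 ^+ q * (X * e) = (8 * T + 1) * X * (4 ^+ q * e)
    by ring.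
  rewrite -[leRHS]mulrA; apply: ler_wpM2l hexp.
  by rewrite mulr_ge0 // addr_ge0 // mulr_ge0 // ltW.
move=> w hb Hw s t i j sT tT st si tj c.
have := @block_modulus _ (H^~ w) Hw (fun j => Y j w ord0 c) (4 * 4 ^ r) Q
  (8 * 4 ^+ q)^-1 T (3 / 2 * a + 2 ^- k).
have m0 : (0 < 4 * 4 ^ r)%N by rewrite muln_gt0 expn_gt0.
move=> /(_ m0 (fun b bQ => (hb b bQ Hw).1) QT (fun b bQ => (hb b bQ Hw).2 c)).
move=> /(_ s t i j sT tT st si tj) h; apply: le_lt_trans h _.
rewrite /a; lra.
Qed.

(** Here k is fixed, so N and dl may depend on it: once N jumps outlast T, each of the finitely many
    bad events has mass O(dl). *)
Lemma step_estimate (T eta : R) (k : nat) : 0 < T -> 0 < eta ->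
  exists (N : nat) (dl : R), 0 < dl /\
    forall d (Omega : measurableType d) (P : {measure set Omega -> \bar R}) Y H,
    jump_hold_chain D k P Y H ->
    exceptional P eta (fun w => (forall j, 0 <= H j w) ->
      T < jump_time (H^~ w) N /\
      forall j, (j < N)%N -> dl <= H j w /\
        ~~ (T - dl < jump_time (H^~ w) j.+1 <= T)).
Proof.
move=> T0 eta0; pose rate : R := 2 ^+ (2 * k).
have rate0 : 0 < rate by rewrite exprn_gt0.
have c81 : 0 <= (81 / 128 : R) < 1 by apply/andP; split; lra.
have eta2 : 0 < eta / 2 by rewrite divr_gt0.
have [N1 hN1] := geometric_lt c81 M0 eta2.
(* The first summand makes M (81/128)^h small, the second makes h half-mean holding times exceed
   T. *)
pose h := (N1 + (Num.truncn (T * (rate * 2))).+1)%N.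
have hT : T < h%:R * (rate^-1 / 2).
  have fT0 : 0 <= T * (rate * 2) by rewrite !mulr_ge0 // ltW.
  have /andP[_ h2] := truncn_itv fT0.
  rewrite -invfM ltr_pdivlMr ?mulr_gt0 //; apply: lt_le_trans h2 _.
  by rewrite ler_nat leq_addl.
pose N := (4 * h)%N; pose C := N%:R * (M * rate * (1 + N%:R)).
have C0 : 0 <= C by rewrite !mulr_ge0 ?addr_ge0 // ltW.
pose dl := eta / 2 / (C + 1);
  have dl0 : 0 < dl by rewrite !divr_gt0 // ltr_wpDl.
exists N, dl; split=> // d Omega P Y H YH.
have [E [EE Eitv Eneg]] := exponential_law rate0.
have HH := walk_hold_le DB YH EE.
have small j : (j < N)%N -> exceptional P (M * rate * (1 + N%:R) * dl)
    (fun w => (forall j, 0 <= H j w) -> dl <= H j w /\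
        ~~ (T - dl < jump_time (H^~ w) j.+1 <= T)).
  move=> jN.
  have P1 := hold_small M0 Eitv Eneg j HH (ltW dl0).
  have [mA PA] := hold_sum_window (ltW rate0) M0 Eitv j HH dl0 (ltW T0).
  move: mA PA; set A := [set w | _] => mA PA.
  have e1 : exceptional P (M * (rate * dl)) (fun w => dl <= H j w).
    exists (H j @^-1` `]-oo, dl[%classic); split=> //.
      by apply: (measurable_hold (E := E) (Mass := M) (P := P)).
    by move=> w nw; rewrite leNgt; apply/negP => h'; apply: nw;
      rewrite /= in_itv.
  have e2 : exceptional P (M * (rate * (j.+1%:R * dl))) (fun w => ~ A w)
    by exists A.
  apply: exceptionalW (exceptionalI e1 e2).
    have -> : M * (rate * dl) + M * (rate * (j.+1%:R * dl)) =
      M * rate * (1 + j.+1%:R) * dl by ring.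
    apply: ler_wpM2r; first exact: ltW.
    by apply: ler_wpM2l; [rewrite mulr_ge0 // ltW|rewrite lerD2l ler_nat].
  move=> w [h1 h2] Hw; split=> //; apply/negP => h3; apply: h2.
  by split; [move=> i _; exact: Hw|exact: h3].
apply: exceptionalW (exceptionalI (hold_many_exceptional DB YH 0 h)
  (exceptional_forall small)).
  rewrite [eta]splitr; apply: lerD.
    by apply/ltW/hN1; rewrite leq_addr.
  rewrite mulrA -/C /dl mulrA ler_pdivrMr ?ltr_wpDl //.
  by rewrite mulrC ler_wpM2l ?(ltW eta2) // lerDl.
move=> w [h1 h2] Hw; split; last by move=> j jN; exact: h2.
exact: lt_le_trans hT (h1 Hw).
Qed.

End uniform_estimates.

(** * Tightness *)

Lemma compact_step_modulus (R : realType) (T : R) (S : pseudoMetricType R)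
    (A : nat -> set (cadlag T S)) : compact [set: S] -> 0 <= T ->
  (forall k, exists N, exists2 dl, 0 < dl &
     A k `<=` \bigcup_(r in [set` iota 0 N]) @step_set R T S r dl) ->
  (forall e, 0 < e -> exists2 dl, 0 < dl & exists K : nat, forall k,
    (K <= k)%N ->
     A k `<=` modulus dl e) ->
  compact (closure (\bigcup_k A k)).
Proof.
move=> cS T0 Astep Amod; apply: ultra_compact_closure => F UF FA.
have [[k Fk]|nFk] := pselect (exists k, F (A k)).
  have [N [dl dl0 ANdl]] := Astep k.
  have [r _ Fr] := ultra_bigcup UF (filterS ANdl Fk).
  exact: ultra_cvg_step cS dl0 T0 UF Fr.
apply: ultra_cvg_modulus => // e e0; have [dl dl0 [K hK]] := Amod e e0.
exists dl => //.
have FK : F (~` \bigcup_(k in [set` iota 0 K]) A k).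
  have [/(ultra_bigcup UF)[k _ Fk]|//] :=
    in_ultra_setVsetC (\bigcup_(k in [set` iota 0 K]) A k) UF.
  by case: nFk; exists k.
apply: filterS (filterI FA FK) => x [[k _ Akx] nx].
have [kK|Kk] := ltnP k K; last exact: hK Kk _ Akx.
by case: nx; exists k => //=; rewrite mem_iota.
Qed.

Lemma compact_closure_type (R : realType) (n : nat) (D : set 'rV[R]_n)
  (D0 : D 0)
    (B : nat) : (forall x, D x -> forall i, `|x ord0 i| <= B%:R) ->
  compact [set: closure_type D0].
Proof.
move=> DB; pose b : R := B%:R.
pose K := [set v : 'rV[R]_n | forall i, `[- b, b]%classic (v ord0 i)].
have cK : compact K.
  apply: (@rV_compact R _ (fun=> `[- b, b]%classic)) => _.
  exact: segment_compact.
have DK : closure D `<=` K.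
  have /closure_id -> : closed K.
    by apply: compact_closed => //; exact: norm_hausdorff.
  by apply: closureS => x Dx i; rewrite /= in_itv /= -ler_norml; exact: DB.
have cD : compact (closure D).
  by apply: subclosed_compact cK DK; exact: closed_closure.
rewrite compact_ultra => F UF _.
move: cD; rewrite compact_ultra => /(_ _ (ultra_fmap \val UF)) [|x [Dx Fx]].
  rewrite /fmap /=; apply: (@filterS _ F _ setT); last exact: filterT.
  by move=> [z zD] _ /=; exact: set_mem zD.
exists (exist _ x (mem_set Dx) : closure_type D0); split=> //.
apply/cvg_ballP => e e0; exact: (Fx _ (nbhsx_ballx x e e0)).
Qed.

Section path_of_chain.
Context (R : realType) (n : nat) (D : set 'rV[R]_n) (D0 : D 0) (T : R).
Hypothesis T0 : 0 < T.
Variables (h : nat -> R) (y : nat -> 'rV[R]_n) (x : cadlag T (closure_type D0)).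
Hypotheses (h0 : forall j, 0 <= h j) (yD : forall j, D (y j)).
Hypothesis xE : forall (t : time T) (j : nat),
  jump_time h j <= \val t < jump_time h j.+1 -> \val (x t) = y j.

Lemma path_step_set N dl : 0 < dl -> T < jump_time h N ->
  (forall j, (j < N)%N -> dl <= h j /\ ~~ (T - dl < jump_time h j.+1 <= T)) ->
  exists2 r, (r < N)%N & step_set r dl x.
Proof.
move=> dl0 TN hN.
have [r rN /andP[rT Tr]] := jump_time_locate (ltW T0) TN.
(* r is the number of jumps up to T. The shift by one is there because [jump_time h 0] is the start,
   not a jump. *)
exists r => //; pose tau (i : 'I_r) := jump_time h i.+1.
pose v j : closure_type D0 :=
  exist (fun z => z \in closure D) _ (mem_set (subset_closure (yD j))).
have tauE (t : time T) j (i : 'I_r)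
  : jump_time h j <= \val t < jump_time h j.+1 ->
    (tau i <= \val t) = (i < j)%N.
  move=> /andP[jt tj]; apply/idP/idP => [it|ij].
    by rewrite -ltnS; apply: (jump_time_ltW h0); exact: le_lt_trans it tj.
  by apply: le_trans jt; exact: jump_time_le.
exists tau, v; split.
- move=> i; have iN := ltn_trans (ltn_ord i) rN.
  have iT : tau i <= T by apply: le_trans rT; apply: jump_time_le => //;
    exact: ltn_ord.
  have [hi win] := hN i iN; apply/andP; split.
    rewrite /tau jump_timeS; apply: ler_wpDl => //.
    by rewrite /jump_time sumr_ge0.
  by rewrite leNgt; apply: contra win => ->.
- move=> i j; wlog ij : i j / (i < j)%N => [hw ij|].
    have [/hw->//|/hw h'|/val_inj ji] := ltngtP i j.
      by rewrite distrC h' // eq_sym.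
    by rewrite ji eqxx in ij.
  move=> _; have [hj _] := hN j (ltn_trans (ltn_ord j) rN).
  rewrite distrC ger0_norm ?subr_ge0; last by apply: jump_time_le => //;
    exact: ltnW.
  rewrite /tau [jump_time h j.+1]jump_timeS.
  have : jump_time h i.+1 <= jump_time h j by exact: jump_time_le.
  lra.
move=> t; have /andP[t0 tT] := time_itv t.
have [j jr jt] := jump_time_locate t0 (le_lt_trans tT Tr).
apply: val_inj; rewrite (xE jt) /step_fun /=; congr y.
rewrite (eq_card (_ : _ =i [pred i : 'I_r | (i < j)%N])); last first.
  by move=> i; rewrite !inE; exact: tauE.
by rewrite -sum1_card big_ord_narrow ?sum1_card ?card_ord // -ltnS.
Qed.

Lemma path_modulus N dl e : 0 < e -> T < jump_time h N ->
  osc_at T dl e h y -> modulus dl e x.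
Proof.
move=> e0 TN osc s t st.
have /andP[s0 sT] := time_itv s; have /andP[t0 tT] := time_itv t.
have [i _ si] := jump_time_locate s0 (le_lt_trans sT TN).
have [j _ tj] := jump_time_locate t0 (le_lt_trans tT TN).
have hc := osc _ _ _ _ sT tT st si tj.
suff : ball (\val (x s)) e (\val (x t)) by [].
by rewrite (xE si) (xE tj); split=> // a c; rewrite (ord1 a); exact: hc.
Qed.

End path_of_chain.

Lemma bounded_set_coord (R : realType) (n : nat) (D : set 'rV[R]_n)
  : bounded_set D ->
  exists B : nat, forall x, D x -> forall i, `|x ord0 i| <= B%:R.
Proof.
move=> [M [_ DM]]; exists (Num.truncn `|M|).+1 => x Dx i.
have MB : M < (Num.truncn `|M|).+1%:R.
  by apply: le_lt_trans (ler_norm M) _;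
    have /andP[] := truncn_itv (normr_ge0 M).
apply: le_trans (DM _ MB x Dx).
by rewrite [leRHS]/Num.norm /= mx_normrE (le_bigmax _ (fun ij =>
  `|x ij.1 ij.2|) (ord0, i)).
Qed.

(** Half of e goes to the step structure at scale k, and e / 2 * 2^-(j+1) to the precision 1 / (j +
    1), so all precisions hold together. The moduli [f] and thresholds [g] do not depend on k,
    whereas [N] and [dl] do. *)
Lemma exceptional_walk (R : realType) (n : nat) (D : set 'rV[R]_n) (B : nat)
  (DB : forall x, D x -> forall i, `|x ord0 i| <= B%:R) (T e : R)
    : 0 < T -> 0 < e ->
  exists (N : nat -> nat) (dl : nat -> R) (f : nat -> R) (g : nat -> nat),
  [/\ forall k, 0 < dl k, forall j, 0 < f j &
   forall k d (Omega : measurableType d) (P : {measure set Omega -> \bar R})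
     Y H,
   jump_hold_chain D k P Y H ->
   exceptional P e (fun w => [/\ forall j, 0 <= H j w, T < jump_time (H^~ w)
     (N k),
     forall j, (j < N k)%N -> dl k <= H j w /\
        ~~ (T - dl k < jump_time (H^~ w) j.+1 <= T) &
     forall j, (j <= k)%N -> (g j <= k)%N ->
       osc_at T (f j) (j.+1%:R^-1) (H^~ w) (Y^~ w)])].
Proof.
move=> T0 e0; have e20 : 0 < e / 2 by rewrite divr_gt0.
have eps0 j : 0 < j.+1%:R^-1 :> R by rewrite invr_gt0 ltr0n.
have eta0 j : 0 < e / 2 * (1 / 2)
  ^+ j.+1 by rewrite mulr_gt0 // exprn_gt0 // divr_gt0.
have geo m : \sum_(i < m.+1) (1 / 2 : R) ^+ i.+1 = 1 - (1 / 2) ^+ m.+1.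
  elim: m => [|m IH]; first by rewrite big_ord1; lra.
  by rewrite big_ord_recr /= IH [(1 / 2) ^+ m.+2]exprS; lra.
have [f fP] := choice (fun j => modulus_estimate DB T0 (eps0 j) (eta0 j)).
have [g gP] := choice (fun j => (fP j).2).
have [N NP] := choice (fun k => step_estimate DB k T0 e20).
have [dl dlP] := choice NP.
exists N, dl, f, g; split; [by move=> k; exact: (dlP k).1|by move=> j;
  exact: (fP j).1|].
move=> k d Omega P Y H YH.
have osc j : (j < k.+1)%N -> exceptional P (e / 2 * (1 / 2) ^+ j.+1) (fun w =>
    (g j <= k)%N -> (forall i, 0 <= H i w) ->
      osc_at T (f j) (j.+1%:R^-1) (H^~ w) (Y^~ w)).
  move=> _; have [gk|kg] := leqP (g j) k.
    by apply: exceptionalW (gP j k gk _ _ _ _ _ YH).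
  exists set0; split=> //; first by rewrite measure0 lee_fin ltW.
have h := exceptionalI (walk_hold_ge0 DB YH)
  (exceptionalI ((dlP k).2 _ _ _ _ _ YH) (exceptional_sum osc)).
apply: exceptionalW h.
  rewrite add0r [leRHS]splitr lerD2l -mulr_sumr -[leRHS]mulr1.
  apply: ler_wpM2l; first exact: ltW.
  by rewrite geo gerBl exprn_ge0 // divr_ge0.
move=> w [h0 [h1 h2]]; have [h3 h4] := h1 h0; split=> // j jk gk.
exact: h2.
Qed.

Theorem lemma3p2 (R : realType) (n : nat) (n_gt0 : (0 < n)%N)
  (D : set 'rV[R]_n) (openD : open D) (connectedD : connected D)
  (boundedD : bounded_set D) (D0 : D 0)
  (boundaryD : lebesgue_rV (boundary D) = 0%E)
  (T : R) (T_gt0 : 0 < T)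
  (mu : nat -> {measure set (borel (cadlag T (closure_type D0))) -> \bar R})
  (mu_law : forall k, (1 <= k)%N -> walk_law k (mu k)) :
  tight [set k | (1 <= k)%N] mu.
Proof.
move=> e e0; have [B DB] := bounded_set_coord boundedD.
have [N [dl [f [g [dl0 f0 good]]]]] := exceptional_walk DB T_gt0 e0.
(* At scale k only finitely many precisions are demanded, but each j is demanded from some scale
   on. *)
pose A k : set (cadlag T (closure_type D0)) :=
  [set x | (exists2 r, (r < N k)%N & step_set r (dl k) x) /\
     forall j, (j <= k)%N -> (g j <= k)%N -> modulus (f j) (j.+1%:R^-1) x].
exists (closure (\bigcup_k A k)).
  apply: (compact_step_modulus (compact_closure_type DB) (ltW T_gt0))
    => [k|eps eps0].
    exists (N k), (dl k) => // x [[r rN xr] _]; exists r => //=.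
    by rewrite mem_iota.
  pose j := Num.truncn eps^-1; exists (f j) => //; exists (maxn j (g j)) => k.
  rewrite geq_max => /andP[jk gk] x [_ /(_ j jk gk) xj] s t st.
  apply: le_ball (xj s t st); rewrite invf_ple ?posrE ?ltr0n //.
  have e10 : 0 <= eps^-1 by rewrite invr_ge0 ltW.
  by have /andP[_ /ltW] := truncn_itv e10.
move=> k k1; have [d [W [P [Y [H [X [YH mX aeX ->]]]]]]] := mu_law k k1;
  last first.
  apply: sub_sigma_algebra; apply: closed_openC; exact: closed_closure.
have [G [mG PG hG]] := good k _ _ _ _ _ YH.
have [G0 [mG0 PG0 hG0]] := aeX.
have mXC : measurable (X @^-1` (~` closure (\bigcup_k A k))).
  rewrite -[_ @^-1` _]setTI; apply: mX => //.
  apply: sub_sigma_algebra; apply: closed_openC; exact: closed_closure.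
(* Off G and the null set G0, where X may fail to follow Y and H, the path lies in [A k]. *)
apply: (@le_trans _ _ (P (G `|` G0))).
  rewrite /pushforward; apply: le_measure; rewrite ?inE //;
    first exact: measurableU.
  move=> w /= nXw; apply: contrapT => /not_orP[nG nG0]; apply: nXw.
  have [h0 hT hstep hosc] := hG w nG.
  have YD j : D (Y j w).
    by case: YH => /(_ j w) [/connected_component_sub[]].
  have XE : forall (t : time T) j, jump_time (H^~ w)
    j <= \val t < jump_time (H^~ w) j.+1 ->
      \val ((X w : cadlag T (closure_type D0)) t) = Y j w.
    by apply: contrapT => h; apply: nG0; apply: hG0.
  apply: subset_closure; exists k => //; split.
    exact: (path_step_set T_gt0 h0 YD XE (dl0 k) hT hstep).
  move=> j jk gk; apply: (path_modulus XE _ hT (hosc j jk gk)).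
  by rewrite invr_gt0 ltr0n.
apply: (@le_trans _ _ (P G + P G0)%E); first exact: measureU2.
by rewrite PG0 adde0.
Qed.
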